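(* Let $p\ge2$ be an integer and let $(c_n)_{n\ge0}$ be a strictly increasing sequence of integers satisfying the following assumption: there exist finitely many nonnegative integers $t_1,\dots,t_r,h_1,\dots,h_d$ with $h_l\neq0$ for every $l\in\{1,\dots,d\}$, and an infinite subset $I$ of $\mathbb{N}$, such that for every $N\in I$ there exist $i\in\{1,\dots,r\}$ and $l\in\{1,\dots,d\}$ with the property that $h_lc_n\equiv t_i \pmod{p^N-1}$ for infinitely many integers $n$. Then the set $$G_{p,(c_n)}=\bigl\{\mu\in\mathcal{P}_{p,c}(\mathbb{T})\;:\;T_{c_n}\mu\text{ does not converge }w^*\text{ to }\mathrm{Leb}\text{ as }n\to+\infty\bigr\}$$ is residual in $(\mathcal{P}_p(\mathbb{T}),w^* )$.
   Context: $\mathbb{N}$ denotes the positive integers. $\mathbb{T}=\mathbb{R}/\mathbb{Z}$ is the circle group. For an integer $m$, $T_m:\mathbb{T}\to\mathbb{T}$ is $x\mapsto mx \bmod 1$, and $T_m\mu$ is the push-forward measure $T_m\mu(C)=\mu(T_m^{-1}C)$. $\mathcal{P}(\mathbb{T})$ is the set of Borel probability measures on $\mathbb{T}$ with the topology of $w^*$-convergence ($\mu_k\to\mu$ iff $\int f\,d\mu_k\to\int f\,d\mu$ for all continuous $f$ on $\mathbb{T}$). $\mathcal{P}_p(\mathbb{T})$ is the set of $\mu\in\mathcal{P}(\mathbb{T})$ with $T_p\mu=\mu$, with the induced topology (a compact metrizable space), and $\mathcal{P}_{p,c}(\mathbb{T})$ is the set of those $\mu\in\mathcal{P}_p(\mathbb{T})$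 which have no atom. $\mathrm{Leb}$ is the normalised Lebesgue measure on $\mathbb{T}$. A subset of a Polish space is residual if it contains a dense $G_\delta$ set. *)

(* Defs.v *)
From HB Require Import structures.
From mathcomp Require Import all_boot all_order all_algebra.
From mathcomp Require Import all_classical all_reals all_analysis.
From mathcomp Require Import measurable_realfun borel_hierarchy.

Set Implicit Arguments.
Unset Strict Implicit.
Unset Printing Implicit Defensive.
Import Order.TTheory GRing.Theory Num.Theory.
Import numFieldNormedType.Exports.

Local Open Scope classical_set_scope.
Local Open Scope ring_scope.
Local Open Scope quotient_scope.

Definition integers (R : realType) :=
  GRing.ZmodClosed.clone R (@Num.int_num_subdef R) _.

(* The quotient group R / Z with the quotient topology and its Borel
   sigma-algebra. *)
Definition circle (R : realType) : Type :=
  quotient_topology (Quotient.quot (integers R)).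

Section circle.
Variable R : realType.
Local Notation T := (circle R).

HB.instance Definition _ := Quotient.on T.
HB.instance Definition _ := Topological.on T.
HB.instance Definition _ := GRing.isZmodule.Build T
  (@Quotient.addqA R (integers R)) (@Quotient.addqC R (integers R))
  (@Quotient.add0q R (integers R)) (@Quotient.addNq R (integers R)).
HB.instance Definition _ := isPointed.Build T 0.
HB.instance Definition _ :=
  Measurable.copy T (g_sigma_algebraType (open : set (set T))).

Definition to_circle (x : R) : T := \pi_T x.

Lemma to_circleD : {morph to_circle : x y / x + y}.
Proof. exact: Quotient.pi_add. Qed.

Lemma to_circleN : {morph to_circle : x / - x}.
Proof. exact: Quotient.pi_opp. Qed.

Lemma to_circle_eq x y : to_circle x = to_circle y <-> x - y \is a Num.int.
Proof.
have e : reflect (x = y %[mod Quotient.quot (integers R)])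
  (x - y \in (integers R : {pred R})).
  by rewrite Quotient.idealrBE; exact: eqP.
by split=> [/e|/e].
Qed.

Lemma to_circleMn x n : to_circle (x *+ n) = to_circle x *+ n.
Proof.
elim: n => [|n ih]; last by rewrite !mulrS to_circleD ih.
by rewrite !mulr0n; exact: (@pi_zeror _ _ _ _ _ (Quotient.quot (integers R))).
Qed.

Lemma to_circleMz x (m : int) : to_circle (x *~ m) = to_circle x *~ m.
Proof.
by case: m => n; rewrite ?NegzE ?mulrNz ?to_circleN -!pmulrn to_circleMn.
Qed.

Lemma to_circle_continuous : continuous to_circle.
Proof. exact: pi_continuous. Qed.

Lemma measurable_circleP d (X : measurableType d) (f : X -> T) :
  (forall U, open U -> measurable (f @^-1` U)) -> measurable_fun setT f.
Proof.
move=> h; apply: (@measurability _ _ _ _ _ _ (@open T)) => //.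
by move=> _ [U oU <-]; rewrite setTI; exact: h.
Qed.

(* [to_circle], on the copy of the line that carries [uniform_prob] *)
Definition line_to_circle : measurableTypeR R -> T := to_circle.

Lemma measurable_line_to_circle : measurable_fun setT line_to_circle.
Proof.
apply: measurable_circleP => U oU; apply: open_measurable.
by move/continuousP: to_circle_continuous; exact.
Qed.

HB.instance Definition _ :=
  @isMeasurableFun.Build _ _ _ _ line_to_circle measurable_line_to_circle.

Definition times (m : int) (x : T) : T := x *~ m.

Lemma times_continuous m : continuous (times m).
Proof.
apply/(@quotient_continuous _ (Quotient.quot (integers R)) T).
have -> : times m \o \pi_T = to_circle \o (fun x => x *~ m).
  by apply/funext => x /=; rewrite to_circleMz.
move=> x; apply: continuous_comp; last exact: to_circle_continuous.
have -> : (fun y : R => y *~ m) = *%R^~ m%:~R.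
  by apply/funext => y; rewrite mulrzr.
exact: mulrr_continuous.
Qed.

Lemma measurable_times m : measurable_fun setT (times m).
Proof.
apply: measurable_circleP => U oU; apply: sub_sigma_algebra.
by move/continuousP: (@times_continuous m); exact.
Qed.

HB.instance Definition _ m :=
  isMeasurableFun.Build _ _ T T (times m) (measurable_times m).

End circle.
Arguments times {R}.

Definition integrate (R : realType) (mu : probability (circle R) R) :
    {ptws continuousType (circle R) R -> R} :=
  fun f => \int[mu]_x f x.

(* The w*-topology is the coarsest one making every mu |-> \int f dmu, with f
   continuous, continuous.  Pitfall: an element of [probability] is a function
   on all sets, constrained on measurable sets only, so two distinct elements
   may represent the same measure.  They are then topologically
   indistinguishable, and belong to the same sets among those defined below;
   this is why invariance is stated on measurable sets, not as [push p mu = mu]. *)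
HB.instance Definition _ (R : realType) :=
  Topological.copy (probability (circle R) R)
    (initial_topology (@integrate R)).

Lemma weak_star_cvgP (R : realType) (F : set_system (probability (circle R) R))
    (mu : probability (circle R) R) : Filter F ->
  F --> mu <->
  forall f : continuousType (circle R) R,
    (fun nu : probability (circle R) R => \int[nu]_x f x) @ F -->
    \int[mu]_x f x.
Proof.
move=> FF; split=> [Fmu f|Ff].
  apply: (@cvg_comp _ _ _ (@integrate R) (fun g => g f) F
    (nbhs (integrate mu)) (nbhs (integrate mu f))).
    by apply: cvg_trans (@initial_continuous _ _ (@integrate R) mu);
      exact: cvg_app.
  exact: (@proj_continuous _ (fun=> R) f (integrate mu)).
have Gmu : @integrate R @ F --> integrate mu.
  apply/cvg_sup => f A [_ [[B oB <-] Bmu BA]].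
  by apply: filterS BA _; apply: (Ff f); exact: open_nbhs_nbhs.
move=> A [_ [[B oB <-] Bmu BA]].
by apply: filterS BA _; apply: Gmu; exact: open_nbhs_nbhs.
Qed.

Section measures.
Variable R : realType.
Local Notation P := (probability (circle R) R).

Definition push (m : int) (mu : P) : P := distribution mu (times m).

Definition Leb : P := distribution (uniform_prob (@ltr01 R)) (@line_to_circle R).

Definition invariant_measures (p : int) : set P :=
  [set mu | forall A, measurable A -> push p mu A = mu A].

Definition atomless (mu : P) := forall x, mu [set x] = 0%E.

(* As a subset of the space of T_p-invariant measures, with the topology
   induced by the w*-topology *)
Definition nonequidistributed (p : int) (c : nat -> int) :
    set (invariant_measures p) :=
  set_val @^-1` [set mu : P | atomless mu /\
                              ~ (push (c n) mu @[n --> \oo] --> Leb)].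

End measures.
Arguments Leb {R}.
Arguments nonequidistributed : clear implicits.

Definition residual (X : topologicalType) (A : set X) :=
  exists B : set X, [/\ Gdelta B, dense B & B `<=` A].

(* Main.v *)
Require Import Defs.
From HB Require Import structures.
From mathcomp Require Import all_boot all_order all_algebra.
From mathcomp Require Import all_classical all_reals all_analysis.
From mathcomp Require Import finmap measurable_realfun borel_hierarchy.
From mathcomp Require Import ring lra zify.

Set Implicit Arguments.
Unset Strict Implicit.
Unset Printing Implicit Defensive.
Import Order.TTheory GRing.Theory Num.Theory.
Import numFieldNormedType.Exports.

Local Open Scope classical_set_scope.
Local Open Scope ring_scope.

(** Write hat(k) for the integral of cos (2 pi k x) against mu.  Since there are
finitely many pairs (t_i, h_l), the pigeonhole principle leaves a single pair
(t, h) whose congruence holds for infinitely many N.  If mu is carried by points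
x with (p^N - 1) x = 0 and h c_n = t modulo p^N - 1, then cos (2 pi h c_n x) and
cos (2 pi t x) agree on the support, so hat(h c_n) = hat(t): such a mu is
recurrent along infinitely many n.  The condition

  for every m there is n >= m with 0 < |hat(t)| < 2 |hat(h c_n)|

defines a G_delta set, and it excludes the convergence of T_(c_n) mu to Lebesgue
measure, because hat(h c_n) is the coefficient of index h of T_(c_n) mu and the
coefficient of index h <> 0 of Lebesgue measure vanishes.  The factor 2 only
serves to keep the condition open.

Density rests on averaging along orbits.  Given an invariant mu,
  send x in [0, 1)
to the point of the form k / (p^N - 1) just below it and average the images of
mu under 1, p, ..., p^(N - 1) times this map ([periodic_mean]).  The result is
invariant because p^N acts trivially on these points, it is carried by them, and
it is close to mu because p^j x and p^j k / (p^N - 1) are at distance at most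
about p^(j - N), which is small for most j < N ([mean_shadowing]).  If hat(t)
happens to vanish, mixing in a little of the invariant point mass at 0 repairs
this and keeps hat(h c_n) = hat(t) ([nonzero_coeff_nearby]).

Atomless measures are handled in the same way: convolving mu with the uniform
measure on the orbit of 1 / (p^N - 1) under multiplication by p gives an
invariant measure near mu whose atoms have mass at most 1 / N
([orbit_convolution]).  Having only atoms of mass less than e is not visibly an
open condition, so it is strengthened to one on finitely many integrals of
continuous functions ([small_atoms]).

The conclusion then follows from the Baire property of the space of invariant
measures ([residual_invariant]), which is a closed subset of the space of all
probabilities.  The latter is compact ([probability_compact]): along an
ultrafilter the distribution functions converge pointwise, and the
right-continuous regularization of their limit is the distribution function of a
limit measure. *)

(** * The circle as a compact quotient of the line *)

Section circle_section.
Variable R : realType.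
Local Notation T := (circle R).
Local Notation tc := (@to_circle R).

Lemma to_circle0 : tc 0 = 0.
Proof. by rewrite -[0 in LHS](mulr0n 0) to_circleMn mulr0n. Qed.

Lemma to_circle_int (n : int) : tc n%:~R = 0.
Proof. by rewrite -to_circle0; apply/to_circle_eq; rewrite subr0 intr_int. Qed.

Definition circle_repr (z : T) : R :=
  let x := repr (z : Quotient.quot (integers R)) in x - (Num.floor x)%:~R.

Lemma circle_reprK : cancel circle_repr tc.
Proof.
move=> z; rewrite /circle_repr to_circleD to_circleN to_circle_int subr0.
exact: reprK.
Qed.

Lemma circle_repr_itv z : 0 <= circle_repr z < 1.
Proof.
rewrite /circle_repr; set x := repr _; have := floor_itv x.
by rewrite intrD => /andP[h1 h2]; rewrite subr_ge0 h1 ltrBlDl.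
Qed.

Lemma to_circleK x : 0 <= x < 1 -> circle_repr (tc x) = x.
Proof.
move=> /andP[x0 x1]; have /andP[y0 y1] := circle_repr_itv (tc x).
set y := circle_repr _ in y0 y1 *.
have /to_circle_eq : tc y = tc x by rewrite circle_reprK.
rewrite intrEfloor; set n := Num.floor _ => /eqP yx.
apply/eqP; rewrite -subr_eq0 -yx intr_eq0.
suff : (-1 < n < 1)%R by lia.
by rewrite -!(ltr_int R) yx; lra.
Qed.

(** The preimage of the image of U is the union of its integer translates. *)
Lemma to_circle_open (U : set R) : open U -> open (tc @` U : set T).
Proof.
move=> oU; rewrite /open/= /quotient_open.
rewrite (_ : _ @^-1` _ = \bigcup_(n in [set: int]) ((fun x =>
  x - n%:~R) @^-1` U)).
  apply: bigcup_open => n _; move: U oU; apply/continuousP => x.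
  by apply: continuousB => //; exact: cst_continuous.
apply/seteqP; split => [x [u Uu /to_circle_eq]|x [n _ Uxn]].
  rewrite intrEfloor => /eqP ux; exists (- Num.floor (u - x)) => //=.
    by rewrite mulrNz ux opprK addrC subrK.
exists (x - n%:~R) => //; apply/to_circle_eq.
by rewrite addrAC subrr add0r rpredN intr_int.
Qed.

Lemma open_circle_measurable (U : set T) : open U -> measurable U.
Proof. exact: sub_sigma_algebra. Qed.

(** The representative jumps at 0 only, and on ]0, 1[ it inverts an open map, so
the preimage of a half-line is open or everything. *)
Lemma measurable_circle_repr : measurable_fun setT circle_repr.
Proof.
apply: (measurability _ (RGenOInfty.measurableE R)) => _ [_ [x ->] <-];
  rewrite setTI.
have [x0|x0] := ltP x 0.
  rewrite (_ : _ @^-1` _ = setT) //; apply/seteqP; split => // z _ /=.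
  by rewrite in_itv/= andbT; have := circle_repr_itv z; lra.
apply: open_circle_measurable.
rewrite (_ : _ @^-1` _ = tc @` `]x, 1[); first exact/to_circle_open/itv_open.
apply/seteqP; split => z /=; rewrite in_itv/= ?andbT.
  move=> xz; exists (circle_repr z); last exact: circle_reprK.
  by rewrite /= in_itv/= xz; have /andP[] := circle_repr_itv z.
move=> [y]; rewrite /= in_itv/= => /andP[xy y1] <-.
by rewrite to_circleK// y1 (le_trans x0)// ltW.
Qed.

Lemma circle_compact : compact [set: T].
Proof.
have -> : [set: T] = tc @` `[0, 1].
  apply/seteqP; split => // z _; exists (circle_repr z);
    last exact: circle_reprK.
  by have /andP[z0 z1] := circle_repr_itv z; rewrite /= in_itv/= z0 ltW.
apply: continuous_compact; last exact: segment_compact.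
by apply: continuous_subspaceT; exact: to_circle_continuous.
Qed.

Lemma continuous_circleP (Z : topologicalType) (f : T -> Z) :
  continuous (f \o tc) -> continuous f.
Proof. by move=> ?; apply/(@quotient_continuous _ (Quotient.quot (integers R))
  Z). Qed.

Lemma continuous_circle_bounded (f : T -> R) : continuous f ->
  exists2 M, 0 < M & forall z, `|f z| <= M.
Proof.
move=> cf; have : compact (f @` setT).
  by apply: continuous_compact circle_compact; apply: continuous_subspaceT.
move/compact_bounded => [M [_ /(_ (`|M| + 1))]] h.
exists (`|M| + 1); first by rewrite ltr_wpDl.
by move=> z; apply: h; [rewrite (le_lt_trans (ler_norm _))// ltrDl|exists z].
Qed.

Lemma continuous_circle_measurable
  (f : T -> R) : continuous f -> measurable_fun setT f.
Proof.
move=> cf; apply: (measurability _ (RGenOInfty.measurableE R)) =>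
  _ [_ [x ->] <-]; rewrite setTI.
apply: open_circle_measurable; move/continuousP : cf; apply.
by rewrite set_itvoy; exact: open_gt.
Qed.

(** Uniformity is expressed on the line, where distances are available: Heine's
argument on [0, 1], extended to all reals by periodicity. *)
Lemma continuous_circle_uniform (f : T -> R) (e : R) : continuous f -> 0 < e ->
  exists2 d : R, 0 < d & forall x y : R, `|x - y| < d ->
    `|f (tc x) - f (tc y)| < e.
Proof.
move=> cf e0.
have cg : continuous (f \o tc).
  by move=> x; apply: continuous_comp; [exact: to_circle_continuous|exact: cf].
pose P (d : R) (x : R) := forall y, `|x - y| < d -> `|f (tc x) - f (tc y)| < e.
have /compact_near_coveringP/(_ _ (0^'+) P _) := @segment_compact R 0 1.
case.
  move=> x _.
  have e2 : 0 < e / 2 by rewrite divr_gt0.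
  have /cvgrPdist_lt/(_ _ e2)/nbhs_ballP[r /= r0 hr] := cg x.
  have r2 : 0 < r / 2 by rewrite divr_gt0.
  exists (ball x (r / 2), [set d | d < r / 2]) => /=.
    split; first exact: nbhsx_ballx.
    exact: nbhs_right_lt.
  move=> [x' d] /= [xx' dr] y x'y.
  have h1 := hr x'; have h2 := hr y.
  rewrite /ball/= in xx' h1 h2.
  have {}h1 : `|f (tc x) - f (tc x')| < e / 2 by apply: h1; lra.
  have {}h2 : `|f (tc x) - f (tc y)| < e / 2.
    by apply: h2; have := ler_distD x' x y; lra.
  have := ler_distD (f (tc x)) (f (tc x')) (f (tc y)).
  by rewrite (distrC (f (tc x')) (f (tc x))); lra.
move=> d /= d0 hd; exists (d / 2); first by rewrite divr_gt0.
move=> x y xy; have d2 : 0 < d / 2 by rewrite divr_gt0.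
have dd : `|0 - d / 2| < d by rewrite sub0r normrN gtr0_norm//; lra.
set n := Num.floor x.
have tE u : tc u = tc (u - n%:~R).
  by apply/to_circle_eq; rewrite opprB addrC subrK intr_int.
rewrite (tE x) (tE y); apply: (hd (d / 2) dd d2).
  have /andP[h1 h2] := floor_itv x; rewrite intrD in h2.
  by rewrite /= in_itv/= -/n subr_ge0 h1 lerBlDl ltW.
by rewrite opprB addrA subrK.
Qed.

End circle_section.

(** * Integrals of bounded functions and averages of probabilities *)

Section bounded_integrals.
Context d (S : measurableType d) (R : realType) (P : probability S R).
Implicit Types (f g : S -> R) (M : R).

Lemma bounded_integrable f M : measurable_fun setT f ->
  (forall x, `|f x| <= M) ->
  P.-integrable setT (EFin \o f).
Proof.
move=> mf fM; apply: measurable_bounded_integrable => //.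
  exact: fin_num_fun_lty (fin_num_measure P).
exists M; split; first exact: num_real.
by move=> N MN x _; rewrite /= (le_trans (fM x))// ltW.
Qed.

Lemma Rintegral_probability_cst (c : R) : \int[P]_x c = c.
Proof. by rewrite Rintegral_cst// [X in fine X](probability_setT P) mulr1. Qed.

Lemma norm_Rintegral_le f M : measurable_fun setT f ->
  (forall x, `|f x| <= M) ->
  `|\int[P]_x f x| <= M.
Proof.
move=> mf fM; have iF := bounded_integrable mf fM.
apply: (le_trans (le_normr_Rintegral measurableT iF)).
rewrite -[leRHS]Rintegral_probability_cst; apply: le_Rintegral => //.
  apply: (@bounded_integrable _ M) => [|x]; last by rewrite normr_id.
  exact: measurableT_comp mf.
by apply: (@bounded_integrable _ `|M|).
Qed.

Lemma Rintegral_dist f g M N e : measurable_fun setT f ->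
  (forall x, `|f x| <= M) ->
  measurable_fun setT g -> (forall x, `|g x| <= N) ->
  (forall x, `|f x - g x| <= e) -> `|\int[P]_x f x - \int[P]_x g x| <= e.
Proof.
move=> mf fM mg gN fg.
rewrite -RintegralB//;
  [|exact: bounded_integrable fM|exact: bounded_integrable gN].
by apply: norm_Rintegral_le => //; exact: measurable_funB.
Qed.

Lemma norm_sum_le n (f : nat -> S -> R) M x : (forall i, `|f i x| <= M) ->
  `|\sum_(i < n) f i x| <= n%:R * M.
Proof.
move=> fM; apply: (le_trans (ler_norm_sum _ _ _)).
apply: (@le_trans _ _ (\sum_(i < n) M)); first exact: ler_sum.
by rewrite sumr_const card_ord mulr_natl.
Qed.

Lemma Rintegral_sum n (f : nat -> S -> R) M :
  (forall i, measurable_fun setT (f i)) ->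
  (forall i x, `|f i x| <= M) ->
  \int[P]_x (\sum_(i < n) f i x) = \sum_(i < n) \int[P]_x f i x.
Proof.
move=> mf fM; elim: n => [|n ih].
  by under eq_Rintegral do rewrite big_ord0;
    rewrite big_ord0 Rintegral_probability_cst.
under eq_Rintegral do rewrite big_ord_recr/=.
rewrite RintegralD//; first by rewrite ih big_ord_recr.
  apply: (@bounded_integrable _ (n%:R * M)); first exact: measurable_sum.
  by move=> x; exact: norm_sum_le.
exact: bounded_integrable (fM n).
Qed.

End bounded_integrals.

Lemma Rintegral_law d d' (S : measurableType d) (S' : measurableType d')
    (R : realType) (P : probability S R) (X : {mfun S >-> S'}) (f : S' -> R) M :
  measurable_fun setT f -> (forall x, `|f x| <= M) ->
  \int[distribution P X]_y f y = \int[P]_x f (X x).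
Proof.
move=> mf fM; rewrite /Rintegral; congr fine.
rewrite integral_distribution//; first exact/measurable_EFinP.
apply: (@bounded_integrable _ _ _ _ (f \o X) M) => [|x]; last exact: fM.
by apply: (measurableT_comp mf).
Qed.

Section average.
Context d (S : measurableType d) (R : realType) (n : nat).
Variable m : 'I_n.+1 -> probability S R.

Let m' (i : nat) : probability S R := m (inord i).

(** An average over n + 1 terms, so that it is a probability for every n. *)
Definition average : set S -> \bar R :=
  mscale (n.+1%:R^-1)%:nng (msum m' n.+1).

HB.instance Definition _ := Measure.on average.

Lemma averageE A : average A = (n.+1%:R^-1%:E * \sum_(i < n.+1) m i A)%E.
Proof.
rewrite /average /mscale /= /msum; congr (_ * _)%E.
by apply: eq_bigr => i _; rewrite /m' inord_val.
Qed.

Let average_setT : average setT = 1%E.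
Proof.
rewrite averageE; under eq_bigr do rewrite probability_setT.
by rewrite sumEFin sumr_const card_ord -EFinM mulVf// pnatr_eq0.
Qed.

HB.instance Definition _ :=
  @Measure_isProbability.Build _ _ _ average average_setT.

(** Scaling and finite sums of measures are linear for integrals of nonnegative
functions, so f is first shifted by its bound. *)
Lemma Rintegral_average (f : S -> R) M : measurable_fun setT f ->
  (forall x, `|f x| <= M) ->
  \int[average]_x f x = n.+1%:R^-1 * \sum_(i < n.+1) \int[m i]_x f x.
Proof.
move=> mf fM.
have shift (Q : probability S R) : \int[Q]_x f x = \int[Q]_x (f x + M) - M.
  rewrite RintegralD//; [|exact: bounded_integrable fM|].
    by rewrite Rintegral_probability_cst addrK.
  by apply: (@bounded_integrable _ _ _ _ _ `|M|).
have f0 x : (0 <= (f x + M)%:E)%E.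
  by rewrite lee_fin; have := fM x; have := ler_norm (- f x); rewrite normrN;
    lra.
have mf' : measurable_fun setT (EFin \o (fun x => f x + M)).
  by apply/measurable_EFinP; exact: measurable_funD.
rewrite shift; under eq_bigr do rewrite shift.
rewrite sumrB sumr_const card_ord mulrBr -[M *+ _]mulr_natl mulKf ?pnatr_eq0//.
congr (_ - _); rewrite /Rintegral /average.
have fin (Q : probability S R) : (\int[Q]_x (f x + M)%:E \is a fin_num)%E.
  apply: integrable_fin_num => //;
    apply: (@bounded_integrable _ _ _ _ _ (M + M)) => [|x].
    exact: measurable_funD.
  by rewrite (le_trans (ler_normD _ _))// lerD// ger0_norm// (le_trans _ (fM
    x)).
rewrite ge0_integral_mscale// ge0_integral_measure_sum//= fineM//.
  congr (_ * _); rewrite sum_fine => [|i _]; last exact: fin.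
  congr fine.
  by apply: eq_bigr => i _; rewrite /m' inord_val.
rewrite sum_fin_num; apply/allP => _ /mapP[i _ ->]; exact: fin.
Qed.

End average.

(** * Continuous functions with a prescribed cozero set *)

Section testing_functions.
Variable R : realType.
Local Notation T := (circle R).
Local Notation tc := (@to_circle R).
Local Notation P := (probability T R).

Lemma lipschitz_continuous (g : R -> R) :
  (forall x y, g x <= g y + `|x - y|) -> continuous g.
Proof.
move=> gl x; apply/cvgrPdist_lt => e e0; near=> y.
have xy : `|x - y| < e by near: y; apply: cvgr_dist_lt => //; exact: cvg_id.
rewrite (le_lt_trans _ xy)// ler_norml; apply/andP; split.
  by have := gl y x; rewrite distrC; lra.
by have := gl x y; lra.
Unshelve. all: by end_near. Qed.

(** Up to a constant, f is the distance to the complement of O, computed on the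
line between a lift and the preimage of that complement. *)
Lemma cozero_function (O : set T) : open O -> exists f : T -> R,
  [/\ continuous f, forall z, 0 <= f z <= 1 & forall z, O z <-> 0 < f z].
Proof.
move=> oO; have [OT|/existsNP[z0 Oz0]] := pselect (forall z, O z).
  exists (fun=> 1); split => [|z|z]; first exact: cst_continuous.
    by rewrite ler01 lexx.
  by rewrite ltr01; split.
pose D x : set R := [set `|x - y| | y in [set y | ~ O (tc y)]].
have D0 x : has_inf (D x).
  split; last by exists 0 => _ [y _ <-].
  by exists `|x - circle_repr z0|, (circle_repr z0) => //=;
    rewrite circle_reprK.
pose g x := inf (D x).
have gl x y : g x <= g y + `|x - y|.
  rewrite -lerBlDr; apply: lb_le_inf; first by case: (D0 y).
  move=> _ [u Ou <-]; rewrite lerBlDr.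
  have : g x <= `|x - u| by apply: ge_inf; [case: (D0 x)|exists u].
  by move/le_trans; apply; rewrite (addrC `|y - u|) ler_distD.
have g_per x y : tc x = tc y -> g x = g y.
  move=> /to_circle_eq xyZ; congr inf; apply/seteqP; split => _ [u Ou <-].
    exists (u - (x - y)); last by congr `|_|; ring.
    rewrite /= (_ : tc _ = tc u)//; apply/to_circle_eq.
    by rewrite addrAC subrr add0r rpredN.
  exists (u + (x - y)); last by congr `|_|; ring.
  rewrite /= (_ : tc _ = tc u)//; apply/to_circle_eq.
  by rewrite addrAC subrr add0r.
pose f z := g (circle_repr z).
have fE x : f (tc x) = g x by apply: g_per; rewrite circle_reprK.
have cf : continuous f.
  apply: continuous_circleP; rewrite (_ : f \o tc = g); last exact/funext.
  exact: lipschitz_continuous.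
have f0 z : 0 <= f z.
  by apply: lb_le_inf; [case: (D0 (circle_repr z))|move=> _ [u _ <-]].
have fO z : O z <-> 0 < f z.
  split=> [Oz|].
    have oO' : open (tc @^-1` O) by move/continuousP: (@to_circle_continuous
      R); exact.
    have : nbhs (circle_repr z) (tc @^-1` O).
      by apply: open_nbhs_nbhs; split => //=; rewrite circle_reprK.
    move=> /nbhs_ballP[e /= e0 zO]; apply: (lt_le_trans e0).
    apply: lb_le_inf; first by case: (D0 (circle_repr z)).
    by move=> _ [u /= Ou <-]; rewrite leNgt; apply/negP => /zO.
  apply: contraPP => Oz; apply/negP; rewrite -leNgt.
  apply: ge_inf; first by case: (D0 (circle_repr z)).
  by exists (circle_repr z); rewrite /= ?circle_reprK// subrr normr0.
have [M M0 fM] := continuous_circle_bounded cf.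
exists (fun z => f z / M); split => [|z|z].
- by move=> z; apply: (@cvgM _ _ (nbhs z) _ f (cst M^-1));
  [exact: cf|exact: cvg_cst].
- rewrite divr_ge0//; last exact: ltW.
  by rewrite ler_pdivrMr// mul1r (le_trans (ler_norm _)).
- by rewrite pmulr_lgt0 ?invr_gt0// fO.
Qed.

End testing_functions.

(** * Continuous functions determine Borel probabilities *)

Lemma Rintegral_indicator d (S : measurableType d) (R : realType)
    (P : probability S R) (A : set S) : measurable A ->
      \int[P]_x \1_A x = fine (P A).
Proof. by move=> mA; rewrite /Rintegral integral_indic// setIT. Qed.

(** The powers of 1 - f decrease to the indicator of the zero set of f.  With a
cozero function this recovers the measure of any closed set from integrals of
continuous functions. *)
Lemma Rintegral_power_cvg d (S : measurableType d) (R : realType)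
    (P : probability S R) (f : S -> R) :
  measurable_fun setT f -> (forall x, 0 <= f x <= 1) ->
  \int[P]_x (1 - f x) ^+ n @[n --> \oo] --> fine (P [set x | f x = 0]).
Proof.
move=> mf f01; set Z := [set x | f x = 0].
have mZ : measurable Z.
  by rewrite (_ : Z = f @^-1` [set 0])// -[_ @^-1` _]setTI; exact: mf.
have mfn n : measurable_fun setT (fun x => (1 - f x) ^+ n).
  by apply: measurable_funX; exact: measurable_funB.
have fn1 n x : `|(1 - f x) ^+ n| <= 1.
  rewrite normrX exprn_ile1// ger0_norm; have := f01 x; lra.
have m1Z : measurable_fun setT (\1_Z : S -> R) by exact: measurable_indic.
have ptw x : (1 - f x) ^+ n @[n --> \oo] --> (\1_Z x : R).
  have /andP[f0 f1] := f01 x.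
  rewrite indicE; have [/set_mem fx|/negP fx] := boolP (x \in Z).
    by under eq_fun do rewrite fx subr0 expr1n; exact: cvg_cst.
  have fx0 : f x != 0 by apply/eqP => fx0; apply: fx; exact: mem_set.
  by apply: cvg_expr; rewrite ger0_norm; lra.
have ptwE x : [set: S] x -> ((1 - f x) ^+ n)%:E @[n --> \oo] --> (\1_Z x)%:E.
  by move=> _; apply: cvg_EFin (ptw x); exact: nearW.
have i1 : P.-integrable setT (EFin \o cst (1 : R)).
  by apply: (@bounded_integrable _ _ _ _ _ 1) => // x; rewrite normr1.
have [_ _] := @dominated_convergence _ S R P setT measurableT
  (fun n x => ((1 - f x) ^+ n)%:E) (fun x => (\1_Z x)%:E) (EFin \o cst (1 : R))
  (fun n => (measurable_EFinP _ _).2 (mfn n)) ((measurable_EFinP _ _).2 m1Z)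
  (aeW _ ptwE) i1 (aeW _ (fun x n _ => fn1 n x)).
rewrite -Rintegral_indicator// /Rintegral -[X in _ --> X]fineK.
  exact: fine_cvg.
by rewrite integral_indic// fin_num_measure//; exact: measurableI.
Qed.

Section uniqueness.
Variable R : realType.
Local Notation T := (circle R).
Local Notation P := (probability T R).

Lemma continuous_one_sub_power (f : T -> R) n : continuous f ->
  continuous (fun z => (1 - f z) ^+ n).
Proof.
move=> cf z; apply: (@continuous_comp T R R (fun z =>
  1 - f z) (@GRing.exp R ^~ n)).
  by refine (@continuousB R R T (cst 1) f z _ _);
    [exact: cst_continuous|exact: cf].
exact: (@exprn_continuous R n (1 - f z)).
Qed.

Lemma eq_probability (mu nu : P) :
  (forall f : T -> R, continuous f -> \int[mu]_x f x = \int[nu]_x f x) ->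
  forall A, measurable A -> mu A = nu A.
Proof.
move=> eqmn; move=> A mA;
  apply: (@measure_unique _ R T open (fun=> setT) _ _ _ _ mu nu) => //.
- exact: openI.
- by move=> _; exact: openT.
- by rewrite bigcup_const//; exists 0%N.
- move=> O oO.
  have [f [cf f01 fO]] := cozero_function oO.
  have mf := continuous_circle_measurable cf.
  have OE : ~` O = [set x | f x = 0].
    apply/seteqP; split => z /=.
      move=> Oz; apply/eqP; rewrite eq_le; have /andP[-> _] := f01 z.
      by rewrite andbT leNgt; apply/negP => /fO.
    by move=> fz Oz; have /fO := Oz; rewrite fz ltxx.
  have h (Q : P) := @Rintegral_power_cvg _ _ _ Q f mf f01.
  have : fine (mu (~` O)) = fine (nu (~` O)).
    rewrite OE; apply: (cvg_unique _ (h mu)) => //.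
    rewrite (_ : (fun n => _) = fun n => \int[nu]_x (1 - f x) ^+ n);
      first exact: h.
    apply/funext => n; apply: eqmn; exact: continuous_one_sub_power.
  have mO : measurable O by exact: open_circle_measurable.
  have fine1B (a b : \bar R) : (a \is a fin_num)%E -> (b \is a fin_num)%E ->
      fine (1 - a)%E = fine (1 - b)%E -> a = b.
    by move: a b => [a| |] [b| |]//= _ _ /addrI/oppr_inj ->.
  by rewrite !probability_setC//; apply: fine1B; exact: fin_num_measure.
- by move=> _; exact: fin_num_fun_lty (fin_num_measure mu).
Qed.

End uniqueness.

Section weak_star.
Variable R : realType.
Local Notation T := (circle R).
Local Notation P := (probability T R).

Lemma weak_star_cvg_continuous (F : set_system P) (mu : P) : Filter F ->
  F --> mu <-> forall f : T -> R, continuous f ->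
    \int[nu]_x f x @[nu --> F] --> \int[mu]_x f x.
Proof.
move=> FF; split => [/weak_star_cvgP h f cf|h].
  pose cfM := isContinuous.Build _ _ f cf.
  exact: (h (HB.pack_for (continuousType T R) f cfM)).
by apply/weak_star_cvgP => f; apply: h; exact: cts_fun.
Qed.

Lemma Rintegral_weak_star_continuous (f : T -> R) : continuous f ->
  continuous (fun mu : P => \int[mu]_x f x).
Proof.
move=> cf mu; have /weak_star_cvg_continuous : nbhs mu --> mu by exact: cvg_id.
by move=> /(_ f cf).
Qed.

End weak_star.

(** * Right-continuous regularization and Stieltjes sums *)

(** A cluster point of an ultrafilter is a limit, which replaces the extraction
of a subsequence in Helly's selection theorem. *)
Lemma ultra_bounded_cvg (X : Type) (R : realType) (U : set_system X)
  (g : X -> R) (M : R) :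
  UltraFilter U -> (forall x, `|g x| <= M) -> cvg (g x @[x --> U]).
Proof.
move=> UU gM; have PU : ProperFilter U by exact: ultra_proper.
have [|l [_ gl]] := @segment_compact R (- M) M (g @ U) _.
  by apply: nearW => x /=; rewrite in_itv/= -ler_norml.
apply/cvg_ex; exists l => A Al.
have [//|gA] := in_ultra_setVsetC (g @^-1` A) UU.
by have [x []] := gl (~` A) A gA Al.
Qed.

Section right_regularization.
Variables (R : realType) (F : R -> R).
Hypothesis F_nd : {homo F : x y / x <= y}.
Hypothesis F0 : forall x, x < 0 -> F x = 0.
Hypothesis F1 : forall x, 1 <= x -> F x = 1.

Definition right_reg (x : R) : R := inf [set F y | y in [set y | x < y]].

Let has_inf_right x : has_inf [set F y | y in [set y | x < y]].
Proof.
split; first by exists (F (x + 1)), (x + 1) => //=; rewrite ltrDl.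
by exists (F x) => _ [y /= xy <-]; exact/F_nd/ltW.
Qed.

Lemma right_reg_ge x : F x <= right_reg x.
Proof.
apply: lb_le_inf; first by case: (has_inf_right x).
by move=> _ [y /= xy <-]; exact/F_nd/ltW.
Qed.

Lemma right_reg_le x y : x < y -> right_reg x <= F y.
Proof. by move=> xy; apply: ge_inf; [case: (has_inf_right x)|exists y]. Qed.

Lemma right_reg_nd : {homo right_reg : x y / x <= y}.
Proof.
move=> x y; rewrite le_eqVlt => /predU1P[->//|xy].
exact: le_trans (right_reg_le xy) (right_reg_ge y).
Qed.

Lemma right_reg_right_continuous : right_continuous right_reg.
Proof.
move=> x; apply/cvgrPdist_lt => e e0.
have [_ [y /= xy <-] ye] := inf_adherent e0 (has_inf_right x).
near=> u.
have xu : x < u by near: u; exact: nbhs_right_gt.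
have uy : u < y by near: u; exact: nbhs_right_lt.
have := right_reg_nd (ltW xu); have := right_reg_le uy.
rewrite -/(right_reg x) in ye => h1 h2.
by rewrite ler0_norm; lra.
Unshelve. all: by end_near. Qed.

Lemma right_reg0 x : x < 0 -> right_reg x = 0.
Proof.
move=> x0; apply/eqP; rewrite eq_le -{2}(F0 x0) right_reg_ge andbT.
by rewrite -(F0 (x := x / 2)); [apply: right_reg_le|]; lra.
Qed.

Lemma right_reg1 x : 1 <= x -> right_reg x = 1.
Proof.
move=> x1; apply/eqP; rewrite eq_le -{2}(F1 x1) right_reg_ge andbT.
by rewrite -(F1 (x := x + 1)); [apply: right_reg_le|]; lra.
Qed.

Lemma right_reg_cvgNy : right_reg @ -oo --> (0 : R).
Proof.
apply: cvg_near_cst; near=> x; apply: right_reg0.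
by near: x; exact: nbhs_ninfty_lt.
Unshelve. all: by end_near. Qed.

Lemma right_reg_cvgy : right_reg @ +oo --> (1 : R).
Proof.
apply: cvg_near_cst; near=> x; apply: right_reg1.
by near: x; exact: nbhs_pinfty_ge.
Unshelve. all: by end_near. Qed.

(** The two functions differ only at discontinuities of F, which are countably
many, whereas an interval has positive Lebesgue measure. *)
Lemma right_reg_eq a b : a < b -> exists2 x, a < x < b & right_reg x = F x.
Proof.
move=> ab; apply: contrapT => noeq.
have lt_reg x : a < x < b -> F x < right_reg x.
  move=> xab; rewrite lt_neqAle right_reg_ge andbT eq_sym.
  by apply/eqP => e; apply: noeq; exists x.
have := @discontinuity_countable R a b F (fun x y _ _ => @F_nd x y).
set D := [set x | _].
have -> : D = `]a, b[%classic.
  apply/seteqP; split => [x [xab _]//|x xab]; split => //.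
  have cl : cvg (F y @[y --> x^'-]).
    apply: nondecreasing_at_left_is_cvgr; first by apply: nearW => u y z _ _;
      exact: F_nd.
    apply: nearW => u; exists (F x) => _ [y /= + <-].
    by rewrite in_itv/= => /andP[_ /ltW/F_nd].
  have cr : cvg (F y @[y --> x^'+]).
    apply: nondecreasing_at_right_is_cvgr;
      first by apply: nearW => u y z _ _; exact: F_nd.
    apply: nearW => u; exists (F x) => _ [y /= + <-].
    by rewrite in_itv/= => /andP[/ltW/F_nd].
  split => //; apply: contraTneq (lt_reg x _) => [lr|]; last by move: xab;
    rewrite /= in_itv.
  rewrite -leNgt; apply: (@le_trans _ _ (lim (F y @[y --> x^'+]))).
    apply: limr_ge => //; near=> y; apply: right_reg_le.
    by near: y; exact: nbhs_right_gt.
  rewrite -lr; apply: limr_le => //; near=> y; apply: F_nd.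
  by near: y; exact: nbhs_left_le.
move/countable_lebesgue_measure0; rewrite lebesgue_measure_itv/= lte_fin ab.
by move=> []; lra.
Unshelve. all: by end_near. Qed.

End right_regularization.

Section stieltjes_sum.
Context d (S : measurableType d) (R : realType) (Q : probability S R).
Variable X : S -> R.
Hypothesis mX : measurable_fun setT X.

Definition law_cdf (x : R) : R := fine (Q [set w | X w <= x]).

Let measurable_le x : measurable [set w | X w <= x].
Proof.
rewrite (_ : [set w | _] = X @^-1` `]-oo, x]).
  by rewrite -[_ @^-1` _]setTI; apply: mX.
by apply/seteqP; split => w /=; rewrite in_itv.
Qed.

(** The sum is the integral of the step function equal to g (a i) on
]a i, a (i + 1)], which is within e of g at every value of X. *)
Lemma stieltjes_sum_approx (g : R -> R) (a : nat -> R) n M e : 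
  measurable_fun setT g -> (forall x, `|g x| <= M) -> 0 <= e ->
  (forall i, a i <= a i.+1) -> (forall w, a 0%N < X w <= a n) ->
  (forall i x, a i < x <= a i.+1 -> `|g x - g (a i)| <= e) ->
  `|\int[Q]_w g (X w) - \sum_(i < n) g (a i) * (law_cdf (a i.+1) -
    law_cdf (a i))| <= e.
Proof.
move=> mg gM e0 a_nd Xa ge.
pose I x : S -> R := \1_[set w | X w <= x].
have mI x : measurable_fun setT (I x) by exact: measurable_indic.
have I1 x w : 0 <= I x w <= 1 by rewrite /I indicE; case: (_ \in _);
  rewrite ?lexx ?ler01.
have IE x w : I x w = (X w <= x)%R%:R.
  by rewrite /I indicE; congr (nat_of_bool _)%:R;
    apply/idP/idP => [/set_mem//|h]; exact/mem_set.
pose h m w := \sum_(i < m) g (a i) * (I (a i.+1) w - I (a i) w).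
have I_le x y w : `|I x w - I y w| <= 1.
  by rewrite ler_norml; have := I1 x w; have := I1 y w; lra.
have mterm i : measurable_fun setT (fun w =>
  g (a i) * (I (a i.+1) w - I (a i) w)).
  by apply: measurable_funM => //; exact: measurable_funB.
have term_le i w : `|g (a i) * (I (a i.+1) w - I (a i) w)| <= M.
  by rewrite normrM -[leRHS]mulr1 ler_pM.
have int_h : \int[Q]_w h n w = \sum_(i < n) g (a i) * (law_cdf (a i.+1) -
  law_cdf (a i)).
  rewrite (Rintegral_sum Q n mterm term_le); apply: eq_bigr => i _.
  have intI x : Q.-integrable setT (EFin \o I x).
    apply: (@bounded_integrable _ _ _ _ _ 1) => // w.
    by rewrite ger0_norm; have := I1 x w; lra.
  rewrite RintegralZl//.
    by rewrite RintegralB// !Rintegral_indicator.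
  by apply: (@bounded_integrable _ _ _ _ _ 1) => //; exact: measurable_funB.
rewrite -int_h; apply: (@Rintegral_dist _ _ _ _ _ _ M (n%:R * M)) => //.
- exact: measurableT_comp.
- exact: measurable_sum.
- by move=> w; apply: (norm_sum_le n (f :=
  fun i w => g (a i) * (I (a i.+1) w - I (a i) w))) => i.
move=> w; have /andP[a0X Xan] := Xa w.
(* the step function stopped at a m vanishes beyond a m and is already correct
before a m *)
suff H m : (X w <= a m -> `|g (X w) - h m w| <= e) /\ (a m < X w -> h m w = 0).
  exact: (H n).1.
elim: m => [|m [IH1 IH2]].
  by split=> [|_]; [rewrite leNgt a0X|rewrite /h big_ord0].
rewrite /h big_ord_recr/= -/(h m w) !IE.
have [Xm|mX'] := leP (X w) (a m).
  rewrite (le_trans Xm (a_nd m)) subrr mulr0 addr0; split=> [_|];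
    first exact: IH1.
  by rewrite ltNge (le_trans Xm (a_nd m)).
rewrite (IH2 mX') add0r; split => [Xm1|m1X].
  by rewrite Xm1 subr0 mulr1; apply: ge; rewrite mX'.
by rewrite leNgt m1X/= subrr mulr0.
Qed.

End stieltjes_sum.

(** * Compactness of the space of probabilities on the circle *)

Section compactness.
Variable R : realType.
Local Notation T := (circle R).
Local Notation tc := (@to_circle R).
Local Notation P := (probability T R).

(** A limit of laws on [0, 1[ may charge the point 1, identified with 0 on the
circle.  Clamping gives a variable with values in [0, 1] everywhere, so that no
exceptional null set has to be carried along. *)
Definition clamp (x : R) : R := Num.max 0 (Num.min 1 x).

Lemma clamp_itv x : 0 <= clamp x <= 1.
Proof. by rewrite /clamp ge_max le_max lexx/= ler01 ge_min lexx. Qed.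

Lemma clamp_le x y : 0 <= y < 1 -> (clamp x <= y) = (x <= y).
Proof.
by move=> /andP[y0 y1]; rewrite /clamp ge_max y0/= ge_min leNgt y1.
Qed.

Definition clamp_to_circle : measurableTypeR R -> T := tc \o clamp.

Lemma measurable_clamp : measurable_fun setT clamp.
Proof. by apply: measurable_maxr => //; apply: measurable_minr. Qed.

Lemma measurable_clamp_to_circle : measurable_fun setT clamp_to_circle.
Proof.
apply: measurableT_comp; first exact: measurable_line_to_circle.
exact: measurable_clamp.
Qed.

HB.instance Definition _ :=
  @isMeasurableFun.Build _ _ _ _ clamp_to_circle measurable_clamp_to_circle.

(** Helly's theorem along an ultrafilter: the limit F of the distribution
functions need not be right continuous, but it agrees with its regularization at
points forming arbitrarily fine partitions, and these suffice to compare the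
Stieltjes sums. *)
Theorem probability_compact : compact [set: P].
Proof.
rewrite compact_ultra => U UU _.
have PU : ProperFilter U by exact: ultra_proper.
pose Fn (nu : P) := law_cdf nu (@circle_repr R).
have mle x : measurable [set z : T | circle_repr z <= x].
  rewrite (_ : [set z | _] = @circle_repr R @^-1` `]-oo, x]).
    by rewrite -[_ @^-1` _]setTI; apply: measurable_circle_repr.
  by apply/seteqP; split => w /=; rewrite in_itv.
have Fn_nd nu : {homo Fn nu : x y / x <= y}.
  move=> x y xy; apply: fine_le;
    [exact: fin_num_measure|exact: fin_num_measure|].
  by apply: le_measure; [exact/mem_set|exact/mem_set|move=> z /= /le_trans;
    exact].
have Fn01 nu x : 0 <= Fn nu x <= 1.
  apply/andP; split; first exact: fine_ge0.
  by rewrite -lee_fin fineK ?fin_num_measure//; exact: probability_le1.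
have Fn0 nu x : x < 0 -> Fn nu x = 0.
  move=> x0; rewrite /Fn /law_cdf (_ : [set w | _] = set0) ?measure0//.
  by apply/seteqP; split => // z /=; have := circle_repr_itv z; lra.
have Fn1 nu x : 1 <= x -> Fn nu x = 1.
  move=> x1; rewrite /Fn /law_cdf (_ : [set w | _] = setT).
    by rewrite [X in fine X](probability_setT nu).
  by apply/seteqP; split => // z _ /=; have := circle_repr_itv z; lra.
pose F x := lim (Fn nu x @[nu --> U]).
have FnF x : Fn nu x @[nu --> U] --> F x.
  apply: (@ultra_bounded_cvg _ _ _ _ 1) => nu.
  by rewrite ger0_norm; have := Fn01 nu x; lra.
have F_nd : {homo F : x y / x <= y}.
  move=> x y xy; apply: ler_cvg_to (FnF x) (FnF y) _.
  by apply: nearW => nu; exact: Fn_nd.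
have F0 x : x < 0 -> F x = 0.
  move=> x0; apply: (cvg_unique _ (FnF x)) => //.
  rewrite (_ : (fun nu => Fn nu x) = cst 0); first exact: cvg_cst.
  by apply/funext => nu; exact: Fn0.
have F1 x : 1 <= x -> F x = 1.
  move=> x1; apply: (cvg_unique _ (FnF x)) => //.
  rewrite (_ : (fun nu => Fn nu x) = cst 1); first exact: cvg_cst.
  by apply/funext => nu; exact: Fn1.
pose G : cumulativeBounded 0 1 := HB.pack (right_reg F) 
  (isCumulative.Build R _ R (right_reg F) (right_reg_nd F_nd)
    (right_reg_right_continuous F_nd))
  (isCumulativeBounded.Build R 0 1 (right_reg F) (right_reg_cvgNy F_nd F0)
    (right_reg_cvgy F_nd F1)).
pose Q : probability (measurableTypeR R) R := lebesgue_stieltjes_measure G.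
have QG x : law_cdf Q clamp x = right_reg F x.
  rewrite /law_cdf; have [x0|x0] := ltP x 0.
    rewrite (_ : [set w | _] = set0) ?measure0 ?right_reg0//.
    apply/seteqP; split => // w /=; have := clamp_itv w; lra.
  have [x1|x1] := leP 1 x.
    rewrite (_ : [set w | _] = setT) ?[X in fine X](probability_setT Q)
      ?right_reg1//.
    apply/seteqP; split => // w _ /=; have := clamp_itv w; lra.
  rewrite (_ : [set w | _] = `]-oo, x]%classic).
    rewrite [X in fine X](_ : _ = (right_reg F x)%:E)//.
    exact: (cdf_lebesgue_stieltjes_id G x).
  by apply/seteqP; split => w /=; rewrite in_itv/= clamp_le// x0.
exists (distribution Q clamp_to_circle : P); split => //.
apply/weak_star_cvg_continuous => f cf.
have mf := continuous_circle_measurable cf.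
have [M M0 fM] := continuous_circle_bounded cf.
rewrite (Rintegral_law _ _ mf fM).
apply/cvgrPdist_lt => e e0.
have e3 : 0 < e / 3 by rewrite divr_gt0.
have [dl d0 fd] := continuous_circle_uniform cf e3.
pose K := (Num.truncn (2 / dl)).+1.
have K0 : 0 < K%:R :> R by rewrite ltr0n.
have Kd : 2 / K%:R < dl.
  by rewrite ltr_pdivrMr// mulrC -ltr_pdivrMr// truncnS_gt.
(* a 0 < 0 and a (K + 1) > 1, so the partition covers [0, 1] *)
have /choice[a aP] (i : nat) : exists x,
    ((i%:R - 1) / K%:R < x < i%:R / K%:R) /\ right_reg F x = F x.
  have [|x xi xF] := right_reg_eq F_nd (a := (i%:R - 1) / K%:R)
    (b := i%:R / K%:R); last by exists x.
  by rewrite ltr_pM2r ?invr_gt0//; lra.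
have aS i : a i <= a i.+1.
  have [/andP[_ h1] _] := aP i; have [/andP[h2 _] _] := aP i.+1.
  by rewrite -natr1 addrK in h2; lra.
have aSd i : a i.+1 - a i < dl.
  have [/andP[h1 _] _] := aP i; have [/andP[_ h2] _] := aP i.+1.
  apply: lt_trans Kd; rewrite -natr1 in h2.
  have -> : 2 / K%:R = (i%:R + 1) / K%:R - (i%:R - 1) / K%:R :> R by field;
    rewrite gt_eqF.
  lra.
have a0 : a 0%N < 0 by have [/andP[_ +] _] := aP 0%N; rewrite mul0r.
have aK : 1 < a K.+1.
  have [/andP[+ _] _] := aP K.+1; rewrite -natr1 addrK divff//;
    exact: lt0r_neq0.
pose sum_of (H : R -> R) :=
  \sum_(i < K.+1) f (tc (a i)) * (H (a i.+1) - H (a i)).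
have approx d (S : measurableType d) (P' : probability S R) (X : S -> R) :
    measurable_fun setT X -> (forall w, 0 <= X w <= 1) ->
    `|\int[P']_w f (tc (X w)) - sum_of (law_cdf P' X)| <= e / 3.
  move=> mX X01.
  apply: (@stieltjes_sum_approx _ _ _ _ _ mX (f \o tc) a K.+1 M) => //.
  - apply: (measurableT_comp mf); exact: measurable_line_to_circle.
  - by move=> x; exact: fM.
  - exact: ltW.
  - by move=> w; have := X01 w; lra.
  - by move=> i x /andP[ix xi]; apply/ltW/fd; have := aSd i;
    rewrite ger0_norm; lra.
have SQ := approx _ _ Q clamp measurable_clamp clamp_itv.
have Snu (nu : P) : `|\int[nu]_w f w - sum_of (Fn nu)| <= e / 3.
  rewrite (_ : \int[nu]_w f w = \int[nu]_w f (tc (circle_repr w))).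
    apply: approx; first exact: measurable_circle_repr.
    by move=> w; have := circle_repr_itv w; lra.
  by apply: eq_Rintegral => w _; rewrite circle_reprK.
have Scvg : sum_of (Fn nu) @[nu --> U] --> sum_of (law_cdf Q clamp).
  apply: cvg_big => [|i _]; first exact: add_continuous.
  rewrite !QG (aP i).2 (aP i.+1).2.
  by apply: cvgM; [exact: cvg_cst|apply: cvgB; exact: FnF].
move/cvgrPdist_lt : Scvg => /(_ _ e3); apply: filterS => nu.
rewrite /= => st.
set IQ := \int[Q]_w _ in SQ *; set s := sum_of _ in SQ st.
have {Snu} := Snu nu; set Inu := \int[nu]_w _; set t := sum_of _ in st *.
have -> : IQ - Inu = (IQ - s) + (s - t) - (Inu - t) by ring.
have := ler_normB ((IQ - s) + (s - t)) (Inu - t).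
have := ler_normD (IQ - s) (s - t).
lra.
Qed.

End compactness.

(** * Baire category in the space of invariant measures *)

(** The usual nested construction: regularity shrinks each open set so that its
closure stays inside the next condition, and a cluster point of the chosen
points lies in all the closures.  Only the trace of the open sets on K matters,
which is what a density statement in the subspace K provides. *)
Lemma baire_compact_regular (X : topologicalType) (K V : set X)
  (W : nat -> set X) :
  regular_space X -> compact K -> (forall n, open (W n)) ->
  (forall n (U : set X), open U -> U `&` K !=set0 -> U `&` K `&` W n !=set0) ->
  open V -> V `&` K !=set0 -> V `&` K `&` \bigcap_n W n !=set0.
Proof.
move=> regX cK oW dW oV VK0.
have step (Un : set X * nat) : exists U' : set X, open Un.1 ->
  Un.1 `&` K !=set0 ->
    [/\ open U', U' `&` K !=set0 & closure U' `<=` Un.1 `&` W Un.2].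
  case: Un => U n /=; have [oU|] := pselect (open U); last by exists set0.
  have [/(dW n _ oU)[x [[Ux Kx] Wx]]|] := pselect (U `&` K !=set0);
    last by exists set0.
  have /regX[A xA AUW] : nbhs x (U `&` W n).
    by apply: open_nbhs_nbhs; split => //; exact: openI.
  exists A° => _ _; split; first exact: open_interior.
    by exists x; split.
  exact: subset_trans (closure_subset (@interior_subset _ A)) AUW.
have /choice[next nextP] := step.
pose Vn := fix Vn n := if n is m.+1 then next (Vn m, m) else V.
have VnP n : open (Vn n) /\ Vn n `&` K !=set0.
  by elim: n => [//|n [oVn VnK]]; have [] := nextP (Vn n, n) oVn VnK.
have VnS n : closure (Vn n.+1) `<=` Vn n `&` W n.
  by have [? ?] := VnP n; have [] := nextP (Vn n, n).
have Vn_sub m n : (m <= n)%N -> Vn n `<=` Vn m.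
  elim: n => [|n ih]; first by rewrite leqn0 => /eqP->.
  rewrite leq_eqVlt => /predU1P[->//|/ih nm].
  apply: subset_trans nm; apply: subset_trans (@subset_closure _ _) _.
  by move=> x /VnS[].
have /choice[x xP] : forall n, exists x, Vn n x /\ K x.
  by move=> n; have [_ [x [? ?]]] := VnP n; exists x.
have [|y [Ky clx]] := cK (x n @[n --> \oo]) _.
  by exists 0%N => // n _; exact: (xP n).2.
have yV n : closure (Vn n) y.
  move=> B yB; have nearVn : \forall m \near \oo, Vn n (x m).
    by exists n => // m /= nm; exact: (Vn_sub _ _ nm _ (xP m).1).
  exact: (clx (Vn n) B nearVn yB).
exists y; split; first by split => //; have [] := VnS 0%N y (yV 1%N).
by move=> n _; have [] := VnS n y (yV n.+1).
Qed.

Section invariant.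
Variable R : realType.
Local Notation T := (circle R).
Local Notation P := (probability T R).

(** The w*-topology is initial for a map into a uniform space. *)
Lemma probability_regular : regular_space P.
Proof. exact: (@uniform_regular (initial_topology (@integrate R))). Qed.

Lemma Rintegral_push (m : int) (mu : P) (f : T -> R) : continuous f ->
  \int[push m mu]_x f x = \int[mu]_x f (times m x).
Proof.
move=> cf; have [M _ fM] := continuous_circle_bounded cf.
exact: (Rintegral_law _ _ (continuous_circle_measurable cf) fM).
Qed.

Lemma continuous_comp_times (m : int) (f : T -> R) : continuous f ->
  continuous (f \o times m).
Proof. by move=> cf x; apply: continuous_comp;
  [exact: times_continuous|exact: cf]. Qed.

(** Invariance on measurable sets is tested by continuous functions, which makes
it a closed condition. *)
Lemma invariantP (p : int) (mu : P) : invariant_measures p mu <->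
  forall f : T -> R, continuous f -> \int[mu]_x f (times p x) = \int[mu]_x f x.
Proof.
split=> [inv f cf|inv].
  rewrite -Rintegral_push// /Rintegral; congr fine.
  by apply: eq_measure_integral => A mA _; exact: inv.
by apply: eq_probability => f cf; rewrite Rintegral_push// inv.
Qed.

Lemma closed_invariant (p : int) : closed (@invariant_measures R p).
Proof.
rewrite (_ : invariant_measures p = \bigcap_(f in [set f : T ->
  R | continuous f])
    ((fun mu : P => \int[mu]_x f (times p x) - \int[mu]_x f x) @^-1` [set 0])).
  apply: closed_bigI => f cf; apply: closed_comp; last exact: closed_eq.
  move=> mu _; apply: (@cvgB _ _ _ _ (nbhs_filter mu)).
    exact: (Rintegral_weak_star_continuous (@continuous_comp_times p f cf)).
  exact: (Rintegral_weak_star_continuous cf).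
apply/seteqP; split => [mu /invariantP inv f cf /=|mu inv];
  first by rewrite inv// subrr.
by apply/invariantP => f cf; apply/eqP; rewrite -subr_eq0; apply/eqP;
  exact: inv.
Qed.

Lemma compact_invariant (p : int) : compact (@invariant_measures R p).
Proof.
by apply: (subclosed_compact (@closed_invariant p) (@probability_compact R)).
Qed.

(** The open sets W n live in the space of all probabilities; each of them only
has to be met by invariant measures near any given invariant measure. *)
Lemma residual_invariant (p : int) (A : set P) (W : nat -> set P) :
  (forall n, open (W n)) ->
  (forall n (U : set P), open U -> U `&` invariant_measures p !=set0 ->
     U `&` invariant_measures p `&` W n !=set0) ->
  invariant_measures p `&` \bigcap_n W n `<=` A ->
  residual (set_val @^-1` A : set (@invariant_measures R p)).
Proof.
move=> oW dW WA; exists (set_val @^-1` \bigcap_n W n); split.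
- exists (fun n => set_val @^-1` W n); last by rewrite preimage_bigcap.
  by move=> n; exists (W n).
- move=> O [nu nuO] [V oV VE]; rewrite -VE in nuO *.
  have VK : V `&` invariant_measures p !=set0.
    by exists (set_val nu); split => //; apply: set_mem; exact: (valP nu).
  have [mu [[Vmu inv] Wmu]] := baire_compact_regular probability_regular
    (@compact_invariant p) oW dW oV VK.
  by exists (exist _ mu (mem_set inv)).
- by move=> nu Wnu; apply: WA; split => //; apply: set_mem; exact: (valP nu).
Qed.

End invariant.

(** * Averages along pseudo-orbits *)

Lemma sum_lt_le (n L : nat) : (\sum_(i < n) (i < L) <= L)%N.
Proof.
have -> : (\sum_(i < n) (i < L) = minn n L)%N; last exact: geq_minr.
elim: n => [|n ih]; first by rewrite big_ord0 min0n.
by rewrite big_ord_recr/= ih /minn; case: (ltnP n L) => nL; case: ltnP => ?;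
  lia.
Qed.

Section orbit_averages.
Variables (R : realType) (p : nat).
Hypothesis p_ge2 : (2 <= p)%N.
Local Notation T := (circle R).
Local Notation tc := (@to_circle R).
Local Notation P := (probability T R).

Let p_gt0 : 0 < p%:R :> R.
Proof. by rewrite ltr0n; lia. Qed.

Lemma cvg_expVn : (p%:R : R) ^- n @[n --> \oo] --> (0 : R).
Proof.
under eq_fun do rewrite -exprVn; apply: cvg_expr.
by rewrite ger0_norm ?invr_ge0 ?ler0n// invf_lt1// ltr1n; lia.
Qed.

(** For all but a bounded number L of the indices j, counted from the end, the
two points are close enough for f to vary by less than e / 2; the other terms
are bounded and the factor 1 / (n + 1) makes their total small. *)
Lemma mean_shadowing (f : T -> R) e : continuous f -> 0 < e ->
  \forall n \near \oo, forall u v : nat -> R,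
    (forall j, (j <= n)%N -> `|u j - v j| <= p%:R ^- (n - j)) ->
    n.+1%:R^-1 * \sum_(j < n.+1) `|f (tc (u j)) - f (tc (v j))| <= e.
Proof.
move=> cf e0; have e2 : 0 < e / 2 by rewrite divr_gt0.
have [dl d0 fd] := continuous_circle_uniform cf e2.
have [M M0 fM] := continuous_circle_bounded cf.
have [L _ Ld] : \forall L \near \oo, (p%:R : R) ^- L < dl.
  move/cvgrPdist_lt : cvg_expVn => /(_ _ d0); apply: filterS => L.
  by rewrite sub0r normrN ger0_norm// invr_ge0 exprn_ge0// ltW.
near=> n; move=> u v uv.
have n0 : (0 : R) < n.+1%:R by rewrite ltr0n.
have nbig : 2 * M * L%:R <= (e / 2) * n.+1%:R.
  rewrite -ler_pdivrMl// mulrC; near: n.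
  exists (Num.truncn (2 * M * L%:R / (e / 2))) => // n /= nn.
  by apply/ltW/(lt_le_trans (truncnS_gt _)); rewrite ler_nat.
rewrite mulrC ler_pdivrMr//.
apply: (@le_trans _ _ (\sum_(j < n.+1) (e / 2 + 2 * M * (n - j < L)%N%:R))).
  apply: ler_sum => j _; have jn : (j <= n)%N by rewrite -ltnS.
  have [njL|Lnj] := ltnP (n - j) L.
    have := ler_normB (f (tc (u j))) (f (tc (v j))).
    by have := fM (tc (u j)); have := fM (tc (v j)); rewrite mulr1; lra.
  rewrite mulr0 addr0; apply/ltW/fd.
  by apply: (le_lt_trans (uv j jn)); exact: Ld.
rewrite big_split/= sumr_const card_ord -[_ *+ _]mulr_natr -mulr_sumr -natr_sum.
have : (\sum_(i < n.+1) (n - i < L) <= L)%N.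
  rewrite (reindex_inj rev_ord_inj)/=.
  rewrite (eq_bigr (fun i : 'I_n.+1 => (i < L : nat)%N));
    first exact: sum_lt_le.
  by move=> i _; rewrite subSS subKn// -ltnS.
rewrite -(ler_nat R) => /(ler_wpM2l (_ : 0 <= 2 * M)) h.
have := h (ltac:(by rewrite mulr_ge0// ltW)); lra.
Unshelve. all: by end_near. Qed.

Section average_of_laws.
Variables (mu : P) (A : nat -> {mfun T >-> T}) (n : nat).

Definition mean_law : P :=
  average (fun j : 'I_n.+1 => distribution mu (A j) : P).

Lemma Rintegral_mean_law (f : T -> R) : continuous f ->
  \int[mean_law]_x f x = n.+1%:R^-1 * \sum_(j < n.+1) \int[mu]_x f (A j x).
Proof.
move=> cf; have mf := continuous_circle_measurable cf.
have [M _ fM] := continuous_circle_bounded cf.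
rewrite /mean_law (Rintegral_average _ mf fM); congr (_ * _).
by apply: eq_bigr => j _; rewrite (Rintegral_law _ _ mf fM).
Qed.

(** Multiplication by m shifts the sequence of laws by one step, and this
sequence closes up after n + 1 steps. *)
Lemma mean_law_invariant (m : int) :
  (forall (f : T -> R), continuous f -> forall j, (j <= n)%N ->
    \int[mu]_x f (times m (A j x)) = \int[mu]_x f (A j.+1 x)) ->
  (forall x, A n.+1 x = A 0%N x) -> invariant_measures m mean_law.
Proof.
move=> AS An; apply/invariantP => f cf.
have cfm := @continuous_comp_times R m f cf.
have /= -> := Rintegral_mean_law cfm.
rewrite (Rintegral_mean_law cf); congr (_ * _).
rewrite big_ord_recr/= AS// big_ord_recl/= addrC; congr (_ + _).
  by apply: eq_Rintegral => x _; rewrite An.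
by apply: eq_bigr => j _; rewrite AS// ltnW.
Qed.

End average_of_laws.

(** The map A n j shadows multiplication by b j, which preserves mu; the error
allowed at time j is p^-(n - j). *)
Lemma mean_law_cvg (mu : P) (b : nat -> int)
  (A : nat -> nat -> {mfun T >-> T}) :
  (forall (f : T -> R), continuous f -> forall j,
    \int[mu]_x f (times (b j) x) = \int[mu]_x f x) ->
  (forall n z, exists u v : nat -> R, forall j, (j <= n)%N ->
    [/\ A n j z = tc (u j),
      times (b j) z = tc (v j) & `|u j - v j| <= p%:R ^- (n - j)]) ->
  (mean_law mu (A n) n : P) @[n --> \oo] --> mu.
Proof.
move=> inv shadow; apply/weak_star_cvg_continuous => f cf.
have mf := continuous_circle_measurable cf.
have [M M0 fM] := continuous_circle_bounded cf.
apply/cvgrPdist_le => e e0; have := mean_shadowing cf e0;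
  apply: filterS => n fn.
rewrite /= (Rintegral_mean_law mu (A n) n cf).
have -> : \int[mu]_x f x = n.+1%:R^-1 * \sum_(j < n.+1) \int[mu]_x f (times (b
  j) x).
  under eq_bigr do rewrite inv//.
  by rewrite sumr_const card_ord -[X in _ * X]mulr_natl mulKf ?pnatr_eq0.
have mD (D : {mfun T >-> T}) : measurable_fun setT (f \o D) by exact:
  measurableT_comp.
have fD (D : {mfun T >-> T}) x : `|f (D x)| <= M by [].
pose D j x := f (times (b j) x) - f (A n j x).
have mDj j : measurable_fun setT (D j) by apply: measurable_funB; exact: mD.
have DM j x : `|D j x| <= M + M.
  by rewrite (le_trans (ler_normB _ _))// lerD.
rewrite -mulrBr -sumrB (eq_bigr (fun j : 'I_n.+1 => \int[mu]_x D j x));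
  last first.
  move=> j _; rewrite RintegralB//.
    exact: (@bounded_integrable _ _ _ _ (f \o times (b j)) M (mD _) (fD _)).
  exact: (@bounded_integrable _ _ _ _ (f \o A n j) M (mD _) (fD _)).
rewrite -(Rintegral_sum mu n.+1 mDj DM) -RintegralZl//; last first.
  apply: (@bounded_integrable _ _ _ _ _ (n.+1%:R * (M + M)));
    first exact: measurable_sum.
  by move=> x; exact: norm_sum_le.
apply: norm_Rintegral_le => [|x].
  by apply: measurable_funM => //; exact: measurable_sum.
have [u [v uv]] := shadow n x.
rewrite normrM ger0_norm ?invr_ge0 ?ler0n//.
apply: le_trans (fn u v (fun j jn => let: And3 _ _ h := uv j jn in h)).
rewrite ler_wpM2l ?invr_ge0 ?ler0n//; apply: (le_trans (ler_norm_sum _ _ _)).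
apply: ler_sum => j _; have jn : (j <= n)%N by rewrite -ltnS.
by rewrite /D distrC; have [-> -> _] := uv j jn.
Qed.

End orbit_averages.

(** * Periodic approximations and small translations of invariant measures *)

Section cosine.
Variable R : realType.
Local Notation T := (circle R).
Local Notation tc := (@to_circle R).
Local Notation P := (probability T R).

Definition circle_cos (z : T) : R := cos (pi *+ 2 * circle_repr z).

Lemma circle_cosE x : circle_cos (tc x) = cos (pi *+ 2 * x).
Proof.
have h (m : nat) (y : R) : cos (y + pi *+ 2 * m%:R) = cos y.
  by rewrite mulr_natr periodicn//; exact: cosD2pi.
rewrite /circle_cos; set y := circle_repr _.
have /to_circle_eq : tc y = tc x by rewrite circle_reprK.
rewrite intrEfloor; case: (Num.floor _) => m /eqP yx.
  by rewrite -(h m (pi *+ 2 * x)) -mulrDr [m%:R]pmulrn yx addrC subrK.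
rewrite -(h m.+1 (pi *+ 2 * y)) -mulrDr; congr (cos (_ * _)).
by rewrite NegzE mulrNz -pmulrn in yx;
  rewrite -[m.+1%:R]opprK yx opprB addrC subrK.
Qed.

Lemma circle_cos_continuous : continuous circle_cos.
Proof.
apply: continuous_circleP; rewrite (_ : _ \o _ = cos \o *%R (pi *+ 2)).
  move=> x; apply: continuous_comp; last exact: continuous_cos.
  exact: mulrl_continuous.
by apply/funext => x /=; rewrite circle_cosE.
Qed.

Lemma circle_cos0 : circle_cos 0 = 1.
Proof. by rewrite -(to_circle0 R) circle_cosE mulr0 cos0. Qed.

Definition fourier_cos (k : int) (mu : P) : R :=
  \int[mu]_x circle_cos (times k x).

Lemma continuous_cos_times k : continuous (circle_cos \o times k).
Proof. exact: (continuous_comp_times circle_cos_continuous). Qed.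

Lemma continuous_fourier_cos k : continuous (fourier_cos k).
Proof. exact: (Rintegral_weak_star_continuous (@continuous_cos_times k)). Qed.

Lemma times_times (k m : int) (z : T) : times k (times m z) = times (k * m) z.
Proof. by rewrite /times -mulrzA mulrC. Qed.

Lemma fourier_cos_push k m mu : fourier_cos k (push m mu) = fourier_cos
  (k * m) mu.
Proof.
rewrite /fourier_cos -[LHS]/(\int[push m mu]_x (circle_cos \o times k) x).
rewrite Rintegral_push; last exact: continuous_cos_times.
by apply: eq_Rintegral => x _; rewrite /= times_times.
Qed.

End cosine.

Section approximations.
Variables (R : realType) (p : nat).
Hypothesis p_ge2 : (2 <= p)%N.
Local Notation T := (circle R).
Local Notation tc := (@to_circle R).
Local Notation P := (probability T R).

(** An average of n + 1 terms corresponds to the period N = n + 1. *)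
Let q (n : nat) : R := p%:R ^+ n.+1 - 1.

Let q_ge n : p%:R ^+ n <= q n.
Proof.
have p2 : (2 : R) <= p%:R by rewrite ler_nat.
have : 1 <= (p%:R : R) ^+ n by rewrite exprn_ege1//; lra.
by rewrite /q exprS; nra.
Qed.

Let p_gt0 : 0 < p%:R :> R.
Proof. by rewrite ltr0n; lia. Qed.

Let q_gt0 n : 0 < q n.
Proof. by apply: lt_le_trans (q_ge n); rewrite exprn_gt0. Qed.

Let pq_le n j : (j <= n)%N -> p%:R ^+ j / q n <= p%:R ^- (n - j).
Proof.
move=> jn; rewrite ler_pdivrMr// ler_pdivlMl ?exprn_gt0//.
by rewrite -exprD subnK.
Qed.

Lemma times_to_circle (m : nat) x : times m%:Z (tc x) = tc (m%:R * x).
Proof. by rewrite /times -to_circleMz mulr_natl. Qed.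

Definition torsion_point (n : nat) (z : T) : T :=
  tc ((Num.floor (q n * circle_repr z))%:~R / q n).

Lemma measurable_torsion_point n : measurable_fun setT (torsion_point n).
Proof.
rewrite (_ : torsion_point n = @line_to_circle R \o
  (fun x => (Num.floor x)%:~R / q n) \o (fun z : T => q n * circle_repr z));
    last by [].
apply: measurableT_comp; last by apply: measurable_funM => //;
  exact: measurable_circle_repr.
apply: measurableT_comp; first exact: measurable_line_to_circle.
apply: measurable_funM => //.
apply: nondecreasing_measurable => // x y xy.
by rewrite ler_int le_floor.
Qed.

HB.instance Definition _ n :=
  isMeasurableFun.Build _ _ T T (torsion_point n) (measurable_torsion_point n).

Definition periodic_map (n j : nat) : {mfun T >-> T} :=
  (times (p ^ j)%N%:Z : {mfun T >-> T}) \o torsion_point n.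

Definition periodic_mean (mu : P) (n : nat) : P :=
  mean_law mu (periodic_map n) n.

Lemma times_torsion_point n z : times ((p ^ n.+1)%N%:Z - 1)
  (torsion_point n z) = 0.
Proof.
rewrite /times /torsion_point -to_circleMz -[RHS](to_circle_int R (Num.floor
  (q n * circle_repr z))).
congr tc; rewrite -mulrzr intrB -pmulrn natrX -/(q n) divfK// gt_eqF//.
Qed.

Lemma times_torsion (k m Q : int) (z : T) : times Q z = 0 ->
  (k = m %[mod Q])%Z ->
  times k z = times m z.
Proof.
move=> Qz km; have Qt u : times (u * Q) z = 0 by rewrite -times_times Qz
  /times mul0rz.
have D a b : times (a + b) z = times a z + times b z by rewrite /times mulrzDr.
have E a : times a z = times (a %% Q)%Z z by rewrite {1}(divz_eq a Q) D Qt
  add0r.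
by rewrite (E k) (E m) km.
Qed.

Lemma fourier_cos_periodic_mean (mu : P) n (k m : int) :
  (k = m %[mod (p ^ n.+1)%N%:Z - 1])%Z ->
  fourier_cos k (periodic_mean mu n) = fourier_cos m (periodic_mean mu n).
Proof.
move=> km.
have := Rintegral_mean_law mu (periodic_map n) n (@continuous_cos_times R k).
have := Rintegral_mean_law mu (periodic_map n) n (@continuous_cos_times R m).
rewrite /fourier_cos /periodic_mean /= => -> ->; congr (_ * _);
  apply: eq_bigr => j _.
apply: eq_Rintegral => x _; congr circle_cos.
apply: times_torsion km;
  rewrite times_times mulrC -times_times times_torsion_point.
by rewrite /times mul0rz.
Qed.

Lemma periodic_mean_invariant mu n : invariant_measures p (periodic_mean mu n).
Proof.
apply: mean_law_invariant => [f cf j _|x].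
  by apply: eq_Rintegral => x _; rewrite /= times_times expnS PoszM.
have := times_torsion_point n x; rewrite /periodic_map /= expn0 => h.
apply: (times_torsion h).
by rewrite -[X in (X %% _)%Z](subrK 1) addrC modzDr.
Qed.

(** The distance from x to its torsion point is at most 1 / q, which
multiplication by p^j turns into p^j / q <= p^-(n - j). *)
Lemma periodic_mean_cvg mu : invariant_measures p mu -> 
  periodic_mean mu n @[n --> \oo] --> mu.
Proof.
move=> inv; apply: (mean_law_cvg p_ge2 (b := fun j => (p ^ j)%N%:Z)).
  move=> f cf; elim => [|j ih].
    by apply: eq_Rintegral => x _; rewrite expn0 /times mulr1z.
  rewrite -ih -[RHS]((invariantP _ _).1 inv _ (@continuous_comp_times R _ f
    cf)).
  by apply: eq_Rintegral => x _; rewrite /= times_times expnSr PoszM.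
move=> n z; exists (fun j =>
  p%:R ^+ j * ((Num.floor (q n * circle_repr z))%:~R / q n)).
exists (fun j => p%:R ^+ j * circle_repr z) => j jn; split.
- by rewrite /= times_to_circle natrX.
- by rewrite -{1}(circle_reprK z) times_to_circle natrX.
- apply: le_trans (pq_le jn).
  rewrite -mulrBr normrM ger0_norm ?exprn_ge0 ?ler0n// ler_wpM2l ?exprn_ge0
    ?ler0n//.
  have /andP[f1 f2] := floor_itv (q n * circle_repr z).
  rewrite distrC ger0_norm.
    rewrite intrD in f2; rewrite lerBlDr -[X in X +
      _]mul1r -mulrDl ler_pdivlMr//.
    by rewrite mulrC addrC ltW.
  by rewrite subr_ge0 ler_pdivrMr// (mulrC (circle_repr z)).
Qed.

(** The orbit of 1 / q under multiplication by p consists of the points p^j / q;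
averaging over it convolves mu with an invariant measure near the point mass
at 0. *)
Definition orbit_translation (n j : nat) (z : T) : T :=
  z + tc (p%:R ^+ j / q n).

Lemma continuous_translation x : continuous (fun z : T => z + tc x).
Proof.
apply: continuous_circleP; rewrite (_ : _ \o _ = tc \o (fun y => y + x)).
  move=> y; apply: continuous_comp; last exact: to_circle_continuous.
  by apply: continuousD => //; exact: cst_continuous.
by apply/funext => y; rewrite /= to_circleD.
Qed.

Lemma measurable_orbit_translation n j : measurable_fun setT
  (orbit_translation n j).
Proof.
apply: measurable_circleP => U oU; apply: open_circle_measurable.
by move/continuousP: (@continuous_translation (p%:R ^+ j / q n)); exact.
Qed.

HB.instance Definition _ n j :=
  isMeasurableFun.Build _ _ T T (orbit_translation n j)
    (measurable_orbit_translation n j).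

Definition orbit_convolution (mu : P) (n : nat) : P :=
  mean_law mu (orbit_translation n) n.

Lemma orbit_convolution_invariant mu n : invariant_measures p mu ->
  invariant_measures p (orbit_convolution mu n).
Proof.
move=> inv; apply: mean_law_invariant => [f cf j _|x].
  have ct : continuous (f \o orbit_translation n j.+1).
    by move=> z; apply: continuous_comp;
      [exact: continuous_translation|exact: cf].
  have /= <- := (invariantP _ _).1 inv _ ct.
  apply: eq_Rintegral => z _; congr f.
  by rewrite /orbit_translation {1}/times mulrzDl -/(times p%:Z z) -/(times
    p%:Z _) times_to_circle exprS mulrA.
rewrite /orbit_translation; congr (_ + _); apply/to_circle_eq.
rewrite expr0 -mulrBl -/(q n) divff ?gt_eqF//.
Qed.

Lemma orbit_convolution_cvg mu :
  orbit_convolution mu n @[n --> \oo] --> mu.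
Proof.
apply: (mean_law_cvg p_ge2 (b := fun=> 1)).
  by move=> f cf _; apply: eq_Rintegral => x _; rewrite /times mulr1z.
move=> n z; exists (fun j =>
  circle_repr z + p%:R ^+ j / q n), (fun=> circle_repr z) => j jn.
split; rewrite ?/times ?mulr1z ?circle_reprK//.
  by rewrite /= /orbit_translation to_circleD circle_reprK.
rewrite addrAC subrr add0r ger0_norm; first exact: pq_le.
by rewrite divr_ge0 ?exprn_ge0 ?ler0n// ltW.
Qed.

End approximations.

(** * Measures with small atoms *)

Section atoms.
Variable R : realType.
Local Notation T := (circle R).
Local Notation tc := (@to_circle R).
Local Notation P := (probability T R).

(** The complement of a point is the image of an open interval of length 1. *)
Lemma open_circle_setC1 (a : T) : open (~` [set a]).
Proof.
have -> : ~` [set a] = tc @` `]circle_repr a, circle_repr a + 1[.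
  have ra := circle_repr_itv a.
  apply/seteqP; split => [z /= za|_ [x /= + <-] xa].
    have rz := circle_repr_itv z.
    have neq : circle_repr z != circle_repr a.
      by apply/eqP => e; apply: za; rewrite -(circle_reprK z) e circle_reprK.
    have [az|za'] := ltP (circle_repr a) (circle_repr z).
      by exists (circle_repr z); rewrite ?circle_reprK//= in_itv/=; lra.
    exists (circle_repr z + 1); first by rewrite /= in_itv/=; lra.
    by rewrite to_circleD (to_circle_int R 1) addr0 circle_reprK.
  rewrite in_itv/= => /andP[ax xa1].
  have /to_circle_eq : tc x = tc (circle_repr a) by rewrite xa circle_reprK.
  rewrite intrEfloor; set m := Num.floor _ => /eqP xm.
  have : (0 < m < 1)%R by rewrite -!(ltr_int R) xm; lra.
  lia.
exact/to_circle_open/itv_open.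
Qed.

Lemma measurable_circle_set1 (a : T) : measurable [set a].
Proof.
have := measurableC (open_circle_measurable (@open_circle_setC1 a)).
by rewrite setCK.
Qed.

(** The functions G a, for a in D, are bumps that cover the circle, and each of
them has a small integral.  This implies that every atom has mass less than e
and, unlike that property, it is visibly w*-open.  The existential family is
finite, so that openness follows from finitely many conditions. *)
Definition small_atoms (e : R) : set P := [set mu : P |
  exists (D : {fset T}) (G : T -> T -> R),
    [/\ forall a, continuous (G a), forall a z, 0 <= G a z,
        forall z, exists2 a, a \in D & 1 <= G a z &
        forall a, a \in D -> \int[mu]_x G a x < e]].

Lemma open_small_atoms e : open (small_atoms e).
Proof.
rewrite openE => mu [D [G [cG G0 G1 Ge]]]; rewrite /interior.
have : nbhs mu [set nu : P | forall a : D, \int[nu]_x G (val a) x < e].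
  apply: (@filter_forall P D (fun a nu =>
    \int[nu]_x G (val a) x < e) _ (nbhs_filter mu)) => a.
  have := @Rintegral_weak_star_continuous R _ (cG (val a)) mu.
  by move=> /cvgr_lt; apply; exact: Ge (valP a).
apply: filterS => nu nuG; exists D, G; split => // a aD.
exact: (nuG [` aD]%fset).
Qed.

Lemma small_atoms_atomless (mu : P) : (forall n : nat,
  small_atoms n.+1%:R^-1 mu) -> atomless mu.
Proof.
move=> mu_small z; apply/eqP; rewrite eq_le measure_ge0 andbT.
have mz := measurable_circle_set1 z.
rewrite -[X in (X <= _)%E]fineK ?fin_num_measure// lee_fin.
apply/ler_addgt0Pr => e e0; rewrite add0r.
have [n ne] : exists n : nat, n.+1%:R^-1 < e.
  exists (Num.truncn e^-1); rewrite invf_plt ?posrE//; exact: truncnS_gt.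
have [D [G [cG G0 G1 Ge]]] := mu_small n.
have [a aD Gaz] := G1 z; have [M M0 GM] := continuous_circle_bounded (cG a).
apply: (le_trans _ (ltW (lt_trans (Ge a aD) ne))).
rewrite -Rintegral_indicator//; apply: le_Rintegral => //.
- apply: (@bounded_integrable _ _ _ _ _ 1); first exact: measurable_indic.
  by move=> x; rewrite indicE ger0_norm//; case: (_ \in _).
- exact: (@bounded_integrable _ _ _ _ _ M (continuous_circle_measurable (cG
  a)) GM).
- move=> x _; rewrite indicE; have [/set_mem ->//|_] := boolP (x \in [set z]).
  exact: G0.
Qed.

(** Around each point a, twice a high power of a function peaking at a is larger
than 1 near a and has integral close to twice the mass of a; compactness leaves
finitely many a. *)
Lemma small_atoms_of_lt (mu : P) e : (forall z, (mu [set z] <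
  (e / 2)%:E)%E) -> small_atoms e mu.
Proof.
move=> mu_lt.
have /choice[G GP] (a : T) : exists g : T -> R,
    [/\ continuous g, forall z, 0 <= g z, 1 < g a & \int[mu]_x g x < e].
  have [f [cf f01 fO]] := cozero_function (@open_circle_setC1 a).
  have mf := continuous_circle_measurable cf.
  have fa : [set x | f x = 0] = [set a].
    apply/seteqP; split => [x /= fx|_ ->] /=.
      by apply: contrapT => /fO; rewrite fx ltxx.
    apply/eqP; rewrite eq_le; have /andP[-> _] := f01 a.
    by rewrite andbT leNgt; apply/negP => /fO; exact.
  have := @Rintegral_power_cvg _ _ _ mu f mf f01; rewrite fa => /cvgr_lt.
  move=> /(_ (e / 2)); rewrite -lte_fin fineK ?fin_num_measure//;
    last exact: measurable_circle_set1.
  move=> /(_ (mu_lt a))[n _ /(_ n (leqnn n)) ne].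
  exists (fun z => 2 * (1 - f z) ^+ n); split.
  - move=> z; apply: (@cvgM _ _ (nbhs z) _ (cst 2) (fun z => (1 - f z) ^+ n)).
      exact: cvg_cst.
    exact: (@continuous_one_sub_power R f n cf z).
  - by move=> z; rewrite mulr_ge0// exprn_ge0//; have := f01 z; lra.
  - have -> : f a = 0 by have : [set x | f x = 0] a by rewrite fa.
    by rewrite subr0 expr1n; lra.
  - rewrite RintegralZl//; first by have := ne; rewrite /=; lra.
    have cp := @continuous_one_sub_power R f n cf.
    have [M _ pM] := continuous_circle_bounded cp.
    exact: (@bounded_integrable _ _ _ _ _ M (continuous_circle_measurable cp)
      pM).
have := @circle_compact R;
  rewrite compact_cover => /(_ T setT (fun a => G a @^-1` `]1, +oo[)).
case.
- move=> a _; have [cg _ _ _] := GP a; move/continuousP : cg; apply.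
  by rewrite set_itvoy; exact: open_gt.
- by move=> z _; exists z => //=; rewrite in_itv/= andbT; have [] := GP z.
move=> D _ DT; exists D, G; split => [a|a|z|a _].
- by have [] := GP a.
- by have [] := GP a.
- by have [a aD /=] := DT z I; rewrite in_itv/= andbT => /ltW; exists a.
- by have [] := GP a.
Qed.

(** The points p^j / q are distinct, so the sets of x sent to z by the various
translations are disjoint and their measures add up to at most 1.  For n > 0
these points are their own representatives in [0, 1[, which separates them. *)
Lemma orbit_convolution_atom (p n : nat) (mu : P) z : (2 <= p)%N -> (0 < n)%N ->
  (orbit_convolution p mu n [set z] <= n.+1%:R^-1%:E)%E.
Proof.
move=> p2 n0; rewrite [X in (X <= _)%E](averageE (fun j : 'I_n.+1 =>
  distribution mu (@orbit_translation R p n j) : P)).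
pose F (j : 'I_n.+1) := @orbit_translation R p n j @^-1` [set z].
have mF j : measurable (F j).
  rewrite -[F j]setTI; apply: measurable_orbit_translation => //.
  exact: measurable_circle_set1.
have yinj (j k : nat) : (j <= n)%N -> (k <= n)%N ->
    tc (p%:R ^+ j / (p%:R ^+ n.+1 - 1)) = tc (p%:R ^+ k / (p%:R ^+ n.+1 -
      1)) -> j = k.
  move=> jn kn; have pR : (2 : R) <= p%:R by rewrite ler_nat.
  have in01 i : (i <= n)%N -> 0 <= (p%:R : R) ^+ i / (p%:R ^+ n.+1 - 1) < 1.
    move=> i_n; have pn : p%:R ^+ i <= (p%:R : R) ^+ n by rewrite
      ler_weXn2l//; lra.
    have p1 : 1 < (p%:R : R) ^+ n by rewrite exprn_egt1 ?gtn_eqF//; lra.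
    have pS : 2 * (p%:R : R) ^+ n <= p%:R ^+ n.+1 by rewrite exprS; nra.
    rewrite divr_ge0 ?exprn_ge0 ?ler0n//=; last lra.
    by rewrite ltr_pdivrMr ?mul1r; lra.
  move=> /(congr1 (@circle_repr R)); rewrite !to_circleK ?in01//.
  have q0 : (p%:R : R) ^+ n.+1 - 1 != 0.
    by rewrite subr_eq0 gt_eqF// exprn_egt1//; lra.
  move=> /(mulIf (invr_neq0 q0)) /eqP.
  by rewrite -!natrX eqr_nat => /eqP /(expnI p2).
have tF : trivIset setT F.
  move=> j k _ _ [x [xj xk]].
  have jn : (j <= n)%N by rewrite -ltnS ltn_ord.
  have kn : (k <= n)%N by rewrite -ltnS ltn_ord.
  apply/val_inj/(yinj _ _ jn kn)/(@addrI _ x).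
  exact: etrans xj (esym xk).
rewrite (eq_bigr (fun j : 'I_n.+1 => mu (F j))); last by [].
have mU : measurable (\big[setU/set0]_(j < n.+1) F j).
  by apply: bigsetU_measurable => j _; exact: mF.
rewrite -measure_bigsetU_ord// muleC; apply: gee_pMl.
- exact: fin_num_measure.
- by rewrite lee_fin.
- exact: probability_le1.
Qed.

End atoms.

(** * Lebesgue measure and mixtures with a point mass *)

Section lebesgue_coefficients.
Variable R : realType.
Local Notation T := (circle R).

(** Adding 1 makes the integrand nonnegative, and a primitive is
sin (w x) / w + x. *)
Lemma fourier_cos_Leb (k : nat) : k != 0%N -> fourier_cos k%:Z (@Leb R) = 0.
Proof.
move=> k0; pose w : R := pi *+ 2 * k%:R.
have w0 : w != 0.
  apply: mulf_neq0; last by rewrite pnatr_eq0.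
  by rewrite mulrn_eq0/=; exact: lt0r_neq0 (pi_gt0 R).
have cC := @continuous_cos_times R k%:Z.
have C1 x : `|(@circle_cos R \o times k%:Z) x| <= 1 by rewrite ler_norml
  cos_le1 cos_geN1.
rewrite /fourier_cos -[LHS]/(\int[Leb]_x (@circle_cos R \o times k%:Z) x).
rewrite (Rintegral_law _ _ (continuous_circle_measurable cC) C1).
pose g (x : measurableTypeR R) : R := cos (w * x).
rewrite (_ : (fun x => _) = g); last first.
  apply/funext => x; rewrite /= /line_to_circle times_to_circle circle_cosE.
  by rewrite mulrA.
have cg : continuous (g : R -> R).
  move=> x; apply: continuous_comp; last exact: continuous_cos.
  exact: mulrl_continuous.
have mg : measurable_fun setT g by exact: continuous_measurable_fun.
have g1 x : `|g x| <= 1 by rewrite ler_norml cos_le1 cos_geN1.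
pose Q := uniform_prob (@ltr01 R).
apply/(addIr 1); rewrite add0r -[X in _ +
  X = _](@Rintegral_probability_cst _ _ _ Q 1).
rewrite -RintegralD//; last 2 first.
- exact: (@bounded_integrable _ _ _ _ _ 1 mg g1).
- by apply: (@bounded_integrable _ _ _ _ _ 1) => // x; rewrite normr1.
rewrite /Rintegral integral_uniform; last 2 first.
- by apply/measurable_EFinP; exact: measurable_funD.
- move=> x; rewrite lee_fin -lerBlDr sub0r; have := g1 x.
  by rewrite ler_norml => /andP[].
pose F (x : R) := w^-1 * sin (w * x) + x.
have dF x : is_derive x (1 : R) F (g x + 1).
  have dw : is_derive x (1 : R) (w \*: id) (w *: 1) by exact: is_deriveZ.
  have ds := is_derive1_comp (is_derive_sin (w * x)) dw.
  have := is_deriveD (is_deriveZ w^-1 ds) (is_derive_id x (1 : R)).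
  move=> /is_derive_eq; apply.
  by rewrite /g /GRing.scale /= mulr1 mulrC mulfK.
have cF : continuous F by move=> x;
  apply/differentiable_continuous/derivable1_diffP; exact: ex_derive.
rewrite (@continuous_FTC2 _ (fun x => g x + 1) F)//.
- rewrite /F !mulr0 sin0 mulr0 mulr1 add0r.
  have -> : sin w = 0.
    have := @periodicn R _ _ _ (@sinD2pi R) k 0.
    by rewrite add0r sin0 /w mulr_natr.
  by rewrite mulr0 add0r subr0 invr1 mul1e sube0.
- by apply: continuous_subspaceT => x; apply: cvgD; [exact: cg|exact: cvg_cst].
- split; [by move=> x _; exact: ex_derive| |].
  + by apply: cvg_at_right_filter; exact: cF.
  + by apply: cvg_at_left_filter; exact: cF.
- by move=> x _; rewrite derive1E derive_val.
Qed.

End lebesgue_coefficients.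

Section dirac_mixture.
Variable R : realType.
Local Notation T := (circle R).
Local Notation P := (probability T R).

Definition dirac_mixture (nu : P) (K : nat) : P :=
  average (fun i : 'I_K.+1 => if val i is 0%N then \d_(0 : T) : P else nu).

Lemma Rintegral_dirac_mixture (nu : P) K (f : T -> R) : continuous f ->
  \int[dirac_mixture nu K]_x f x = K.+1%:R^-1 * (f 0 + K%:R * \int[nu]_x f x).
Proof.
move=> cf; have mf := continuous_circle_measurable cf.
have [M _ fM] := continuous_circle_bounded cf.
rewrite (Rintegral_average _ mf fM) big_ord_recl/=; congr (_ * (_ + _)).
  rewrite /Rintegral integral_dirac//; last exact/measurable_EFinP.
  by rewrite diracT mul1e.
by rewrite sumr_const card_ord mulr_natl.
Qed.

Lemma dirac_mixture_cvg (nu : P) : dirac_mixture nu K @[K --> \oo] --> nu.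
Proof.
apply/weak_star_cvg_continuous => f cf.
suff : (fun K => \int[dirac_mixture nu K]_x f x) @ \oo --> \int[nu]_x f x by [].
rewrite (_ : (fun K => _) = fun K =>
  (K.+1%:R^-1) * (f 0 - \int[nu]_x f x) + \int[nu]_x f x).
  set I0 := \int[nu]_x f x.
  have := cvgD (cvgM (@cvg_harmonic R) (cvg_cst (f 0 - I0))) (cvg_cst I0).
  rewrite mul0r add0r; apply.
apply/funext => K; rewrite Rintegral_dirac_mixture// -[K%:R](addrK 1) natr1.
by field; apply: lt0r_neq0; have := ler0n R K; lra.
Qed.

Lemma dirac_mixture_invariant (nu : P) (m : int) K :
  invariant_measures m nu -> invariant_measures m (dirac_mixture nu K).
Proof.
move=> /invariantP inv; apply/invariantP => f cf.
have /= -> := Rintegral_dirac_mixture nu K (@continuous_comp_times R m f cf).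
by rewrite Rintegral_dirac_mixture// inv// /times mul0rz.
Qed.

Lemma fourier_cos_dirac_mixture (nu : P) K k :
  fourier_cos k (dirac_mixture nu K) = K.+1%:R^-1 * (1 +
    K%:R * fourier_cos k nu).
Proof.
have /= := Rintegral_dirac_mixture nu K (@continuous_cos_times R k).
by rewrite /fourier_cos => ->; rewrite /times mul0rz circle_cos0.
Qed.

(** All coefficients of the point mass at 0 equal 1, so mixing preserves
equalities between coefficients and moves a zero coefficient away from 0. *)
Lemma nonzero_coeff_nearby (nu : P) (m t : int) (U : set P) : open U -> U nu ->
  invariant_measures m nu -> exists sigma : P,
    [/\ U sigma, invariant_measures m sigma, fourier_cos t sigma != 0 &
      forall k, fourier_cos k nu = fourier_cos t nu ->
        fourier_cos k sigma = fourier_cos t sigma].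
Proof.
move=> oU Unu inv; have [nu0|nu0] := eqVneq (fourier_cos t nu) 0;
  last by exists nu.
have [K _ /(_ K (leqnn K)) UK] :=
  @dirac_mixture_cvg nu U (open_nbhs_nbhs (conj oU Unu)).
exists (dirac_mixture nu K); split => //.
- exact: dirac_mixture_invariant.
- by rewrite fourier_cos_dirac_mixture nu0 mulr0 addr0 mulr1 invr_neq0//
  pnatr_eq0.
- by move=> k kt; rewrite !fourier_cos_dirac_mixture kt.
Qed.

End dirac_mixture.

(** * Recurrent Fourier coefficients and the main theorem *)

Lemma infinite_nat_unbounded (A : set nat) m : infinite_set A ->
  exists2 n, A n & (m <= n)%N.
Proof.
move=> infA; apply: contrapT => noA; apply: infA.
apply: (sub_finite_set _ (finite_II m)) => n An /=.
by rewrite ltnNge; apply/negP => mn; apply: noA; exists n.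
Qed.

Lemma infinite_pigeonhole (K : finType) (A : set nat) (B : K -> set nat) :
  infinite_set A -> (forall n, A n -> exists k, B k n) ->
    exists k, infinite_set (A `&` B k).
Proof.
move=> infA AB; apply: contrapT => fin; apply: infA.
have -> : A = \bigcup_(k in [set: K]) (A `&` B k).
  by apply/seteqP; split => [n An|n [k _ []//]]; have [k Bk] := AB n An;
    exists k.
apply: bigcup_finite => [|k _]; first exact: finite_finset.
by apply: contrapT => infk; apply: fin; exists k.
Qed.

Section recurrence.
Variables (R : realType) (p : nat) (c : nat -> int) (h t : nat) (I : set nat).
Hypothesis p_ge2 : (2 <= p)%N.
Hypothesis I_inf : infinite_set I.
Hypothesis congr_I : forall N, I N ->
  infinite_set [set n : nat | (h%:Z * c n = t%:Z %[mod (p ^ N)%N%:Z - 1])%Z].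
Local Notation P := (probability (circle R) R).

(** The strict inequality with factor 2 is an open way of recording the equality
of the two coefficients for periodic measures; the bound it gives does not
depend on n. *)
Definition recurrent (m : nat) : set P := [set mu | exists2 n, (m <= n)%N &
  0 < `|fourier_cos t mu| /\
    `|fourier_cos t mu| < 2 * `|fourier_cos (h%:Z * c n) mu|].

Lemma open_recurrent m : open (recurrent m).
Proof.
have -> : recurrent m = \bigcup_(n in [set n | (m <= n)%N])
    ([set mu : P | 0 < `|fourier_cos t mu|] `&`
     [set mu : P | 0 < 2 * `|fourier_cos (h%:Z * c n) mu| -
       `|fourier_cos t mu|]).
  by apply/seteqP; split => mu [n mn [? ?]]; exists n => //; split;
    rewrite //= ?subr_gt0// -subr_gt0.
have cn k : continuous (fun mu : P => `|fourier_cos k mu|).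
  by move=> mu; exact: (cvg_norm (@continuous_fourier_cos R k mu)).
have cB k : continuous (fun mu : P =>
  2 * `|fourier_cos k mu| - `|fourier_cos t mu|).
  move=> mu; apply: (@cvgB _ _ _ _ (nbhs_filter mu)); last exact: cn.
  by apply: (@cvgM _ _ _ (nbhs_filter mu)); [exact: cvg_cst|exact: cn].
apply: bigcup_open => n _; apply: openI.
  by move/continuousP : (cn t) => /(_ _ (@open_gt R 0)).
by move/continuousP : (cB (h%:Z * c n)) => /(_ _ (@open_gt R 0)).
Qed.

(** For N in I the congruence makes the two coefficients of a periodic mean
equal for infinitely many n. *)
Lemma dense_recurrent m (U : set P) : open U ->
  U `&` invariant_measures p !=set0 ->
  U `&` invariant_measures p `&` recurrent m !=set0.
Proof.
move=> oU [mu [Umu inv]].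
have [N0 _ UN] := periodic_mean_cvg p_ge2 inv (open_nbhs_nbhs (conj oU Umu)).
have [[//|N] IN N0N] := infinite_nat_unbounded N0.+1 I_inf.
have [n cn mn] := infinite_nat_unbounded m (congr_I IN).
have [sigma [Us inv_s t_s ks]] :=
  @nonzero_coeff_nearby R _ p%:Z t U oU (UN N N0N)
  (periodic_mean_invariant p_ge2 mu N).
exists sigma; split => //; exists n => //.
rewrite ks; last exact: fourier_cos_periodic_mean.
by have := normr_gt0 (fourier_cos t sigma); rewrite t_s => ?; split => //; lra.
Qed.

Lemma dense_small_atoms (e : R) (U : set P) : 0 < e -> open U ->
  U `&` invariant_measures p !=set0 ->
  U `&` invariant_measures p `&` small_atoms e !=set0.
Proof.
move=> e0 oU [mu [Umu inv]].
have [N0 _ UN] := @orbit_convolution_cvg R p p_ge2 mu _ (open_nbhs_nbhs (conj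
  oU Umu)).
pose n := maxn N0 (Num.truncn (e / 2)^-1).+1.
exists (orbit_convolution p mu n); split; first split.
- by apply: UN; rewrite /= leq_maxl.
- exact: orbit_convolution_invariant.
- apply: small_atoms_of_lt => z;
  apply: (le_lt_trans (orbit_convolution_atom _ _ p_ge2 _)).
    by rewrite leq_max orbT.
  rewrite lte_fin invf_plt ?posrE//; last by rewrite divr_gt0.
  by rewrite (lt_le_trans (truncnS_gt _))// ler_nat (leq_trans (leq_maxr N0 _)).
Qed.

Lemma recurrent_not_cvg (mu : P) : h != 0%N -> (forall m, recurrent m mu) ->
  ~ (push (c n) mu @[n --> \oo] --> Leb).
Proof.
move=> h0 rec /weak_star_cvg_continuous/(_ _ (@continuous_cos_times R h)).
rewrite -[X in _ --> X]/(fourier_cos h Leb) fourier_cos_Leb//.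
have t0 : 0 < `|fourier_cos t mu| by have [? _ []] := rec 0%N.
have t2 : 0 < `|fourier_cos t mu| / 2 by rewrite divr_gt0.
move=> /cvgrPdist_lt/(_ _ t2)[m _ mP].
have [n mn [_]] := rec m; have := mP n mn.
rewrite /= -[\int[_]_x _]/(fourier_cos h (push (c n) mu)) fourier_cos_push
  sub0r normrN.
lra.
Qed.

End recurrence.

Theorem theorem2p1 (R : realType) (p : nat) (c : nat -> int)
  (p_ge2 : (2 <= p)%N)
  (c_incr : forall m n : nat, (m < n)%N -> c m < c n)
  (r d : nat) (t : 'I_r -> nat) (h : 'I_d -> nat) (I : set nat)
  (h_neq0 : forall l : 'I_d, h l != 0%N)
  (I_pos : forall N : nat, I N -> (0 < N)%N)
  (I_inf : infinite_set I)
  (cong : forall N : nat, I N ->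
    exists (i : 'I_r) (l : 'I_d),
      infinite_set [set n : nat |
        ((h l)%:Z * c n = (t i)%:Z %[mod (p ^ N)%N%:Z - 1])%Z]) :
  residual (nonequidistributed R p%:Z c).
Proof.
pose B (k : 'I_r * 'I_d) := [set N : nat | infinite_set [set n : nat |
  ((h k.2)%:Z * c n = (t k.1)%:Z %[mod (p ^ N)%N%:Z - 1])%Z]].
have [N /cong[i [l il]]|[i l] infJ] := @infinite_pigeonhole _ I B I_inf.
  by exists (i, l).
have congJ N : (I `&` B (i, l)) N -> B (i, l) N by case.
apply: (residual_invariant (W := fun n => small_atoms n.+1%:R^-1 `&`
  recurrent c (h l) (t i) n)).
- by move=> n; apply: openI; [exact: open_small_atoms|exact: open_recurrent].
- move=> n U oU UK.
  have n0 : (0 : R) < n.+1%:R^-1 by rewrite invr_gt0 ltr0n.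
  have [mu [[Umu inv] small]] := dense_small_atoms p_ge2 n0 oU UK.
  have oV : open (U `&` small_atoms n.+1%:R^-1) by apply: openI => //;
    exact: open_small_atoms.
  have VK : (U `&` small_atoms n.+1%:R^-1) `&` invariant_measures p !=set0 by
    exists mu.
  have [nu [[[Unu nu_small] nu_inv] nu_rec]] :=
    dense_recurrent p_ge2 infJ congJ n oV VK.
  by exists nu.
- move=> mu [inv Wmu]; split.
    by apply: small_atoms_atomless => n; have [] := Wmu n Logic.I.
  apply: (@recurrent_not_cvg R c (h l) (t i) mu (h_neq0 l)) => n.
  by have [] := Wmu n Logic.I.
Qed.
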